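(* There exists a universal constant $C>0$ such that the following holds. Let $1<\alpha\le2\le\beta<\infty$ and $K\ge1$, let $\Psi\colon\mathbb{R}^n\to\mathbb{R}$ satisfy condition (C) and the growth condition $(G_{K,\alpha,\beta})$ (both defined in the context), let $D>0$, and let $\mu$ be a probability measure on $\mathbb{R}^n$, absolutely continuous with respect to Lebesgue measure, satisfying the modified logarithmic Sobolev inequality $mLSI(\Psi,D)$. Then for all $\mu$-integrable and locally Lipschitz functions $f\colon\mathbb{R}^n\to\mathbb{R}$ and any $p\ge\beta$, $$\mu\Big(|f-\mathbb{E}_\mu f|\ge C\,L(K,D,\alpha,\beta)\,\Big\||\nabla f|_{\Psi_p}\Big\|_p\Big)\le e^{-p},$$ where $$L(K,D,\alpha,\beta)=\frac1{\alpha-1}(KD)^{1/\beta}+\Big(\frac1{\alpha-1}+\beta^{1/\alpha}\Big)(KD)^{1/\alpha}.$$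
   Context: Condition (C) for $\Psi\colon\mathbb{R}^n\to[0,\infty]$: (C1) $\Psi(0)=0$ and $\Psi$ is continuous at $0$; (C2) $\Psi(x)>0$ for $x\ne0$; (C3) $\lim_{|x|\to\infty}\Psi(x)=\infty$; (C4) for every $x\in\mathbb{R}^n$ the function $t\mapsto\Psi(tx)$ is left-continuous on $(0,\infty)$; (C5) for every $x\in\mathbb{R}^n$ the function $t\mapsto\Psi(tx)/t$ is non-decreasing on $(0,\infty)$; (C6) $\Psi(x)=\Psi(-x)$ for all $x$. Growth condition $(G_{K,\alpha,\beta})$: for all $x\in\mathbb{R}^n\setminus\{0\}$ and all $t\ge1$, $K^{-1}t^\alpha\le\Psi(tx)/\Psi(x)\le Kt^\beta$. $mLSI(\Psi,D)$: for every bounded locally Lipschitz $f\colon\mathbb{R}^n\to(0,\infty)$, $$\mathrm{Ent}_\mu f^2\le D\,\mathbb{E}_\mu\Psi\Big(\frac{\nabla f}{f}\Big)f^2,$$ where $\mathbb{E}_\mu$ is integration with respect to $\mu$ and $\mathrm{Ent}_\mu g=\mathbb{E}_\mu g\log g-\mathbb{E}_\mu g\log\mathbb{E}_\mu g$ for $g\ge 0$. Gradients of locally Lipschitz functions exist Lebesgue-a.e., hence $\mu$-a.e. Norms: for $p>0$, $\Psi_p(x)=\frac1p\Psi(px)$ and $|x|_{\Psi_p}=\inf\{a>0:\Psi_p(x/a)\le1\}$ for $x\in\mathbb{R}^n$ (a quasi-norm). Moments: $\|g\|_p=(\mathbb{E}_\mu|g|^p)^{1/p}$. A universal constant depends on no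 parameters (in particular not on $n$).
   Formalization: The function f is additionally assumed not to be μ-almost everywhere constant; for constant f the gradient norm is 0 and the event |f−E f| ≥ 0 has probability 1 > e^{-p}, so the claim as written fails exactly in that case. *)

(* Defs.v *)
From HB Require Import structures.
From mathcomp Require Import all_boot all_order all_algebra.
From mathcomp Require Import all_classical all_reals all_analysis.
Import Order.TTheory GRing.Theory Num.Theory.
Import numFieldNormedType.Exports.

Set Implicit Arguments.
Unset Strict Implicit.
Unset Printing Implicit Defensive.

Local Open Scope classical_set_scope.
Local Open Scope ring_scope.

(* R^n is 'rV[R]_n with its Borel sigma-algebra.  The library norm on 'rV[R]_n
   is the sup norm; it is only used below through continuity, limits at
   infinity and local Lipschitz continuity, which are the same for all norms. *)
HB.instance Definition _ (R : realType) (m n : nat) :=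
  @isMeasurable.Build (sigma_display (@open 'M[R]_(m, n))) 'M[R]_(m, n)
    <<s @open 'M[R]_(m, n) >>
    (@sigma_algebra0 _ setT _) (@sigma_algebraC _ _)
    (@sigma_algebra_bigcup _ setT _).

(* n-dimensional Lebesgue measure of a Borel set, as an iterated integral of
   its sections (first coordinate outermost). *)
Fixpoint lebesgue_rV (R : realType) (n : nat) : set 'rV[R]_n -> \bar R :=
  match n return set 'rV[R]_n -> \bar R with
  | 0 => fun A => \d_(0 : 'rV[R]_0) A
  | m.+1 => fun A => (\int[@lebesgue_measure R]_t
      lebesgue_rV [set y : 'rV[R]_m | A (row_mx (t%:M : 'rV[R]_1) y)])%E
  end.

Section functions.
Context {R : realType} {n : nat}.
Implicit Types f : 'rV[R]_n -> R.

Definition locally_lipschitz f : Prop :=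
  forall x : 'rV[R]_n, exists2 U, nbhs x U & [lipschitz (f y : R^o) | y in U].

(* A partial derivative that does not exist has the value 0 of the library. *)
Definition grad f (x : 'rV[R]_n) : 'rV[R]_n :=
  \row_(i < n) derive (f : 'rV[R]_n -> R^o) x (delta_mx 0 i).

End functions.

Section conditions.
Context {R : realType} {n : nat}.
Implicit Types Psi : 'rV[R]_n -> R.

Definition condition_C Psi : Prop :=
  [/\ Psi 0 = 0 /\ {for 0, continuous Psi},
      forall x, x != 0 -> 0 < Psi x,
      forall M, exists r, forall x, r < `|x| -> M < Psi x,
      forall x t, 0 < t -> Psi (s *: x) @[s --> t^'-] --> Psi (t *: x) &
      (forall x s t, 0 < s -> s <= t -> Psi (s *: x) / s <= Psi (t *: x) / t) /\
      (forall x, Psi x = Psi (- x))].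

Definition growth_condition Psi (K alpha beta : R) : Prop :=
  forall x t, x != 0 -> 1 <= t ->
    K^-1 * t `^ alpha <= Psi (t *: x) / Psi x <= K * t `^ beta.

Definition Psi_scaled Psi (p : R) (x : 'rV[R]_n) : R := p^-1 * Psi (p *: x).

Definition quasinorm Psi (p : R) (x : 'rV[R]_n) : R :=
  inf [set a | 0 < a /\ Psi_scaled Psi p (a^-1 *: x) <= 1].

End conditions.

Section mLSI.
Context {R : realType} {n : nat}.
Local Open Scope ereal_scope.

Definition Ent (mu : probability 'rV[R]_n R) (g : 'rV[R]_n -> R) : \bar R :=
  'E_mu[fun x => (g x * ln (g x))%R] - 'E_mu[g] * lne 'E_mu[g].

Definition mLSI (mu : probability 'rV[R]_n R) (Psi : 'rV[R]_n -> R) (D : R) :=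
  forall f : 'rV[R]_n -> R, (forall x, 0 < f x)%R ->
    [bounded (f x : R^o) | x in setT] -> locally_lipschitz f ->
    Ent mu (fun x => (f x ^+ 2)%R) <=
      D%:E * 'E_mu[fun x => (Psi ((f x)^-1 *: grad f x) * f x ^+ 2)%R].

End mLSI.

Definition Lconst {R : realType} (K D alpha beta : R) : R :=
  (alpha - 1)^-1 * (K * D) `^ beta^-1 +
  ((alpha - 1)^-1 + beta `^ alpha^-1) * (K * D) `^ alpha^-1.

(* Main.v *)
Require Import Defs.
From HB Require Import structures.
From mathcomp Require Import all_boot all_order all_algebra.
From mathcomp Require Import all_classical all_reals all_analysis.
From mathcomp Require Import measurable_realfun ring lra.
Import Order.TTheory GRing.Theory Num.Theory.
Import numFieldNormedType.Exports.
Import HBNNSimple.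

Set Implicit Arguments.
Unset Strict Implicit.
Unset Printing Implicit Defensive.

Local Open Scope classical_set_scope.
Local Open Scope ring_scope.

(** Let [m] be a median of [f] and [V] a smooth, bounded, positive truncation of
    [(f - m) / M], where [M] is a multiple of [L] times the norm of the gradient.
    For [beta <= t <= p] the inequality [mLSI], applied to [V ^ (t / 2)], bounds
    the entropy of [V ^ t] by [r E V ^ t], and Jensen's inequality turns this into
    the reverse Hoelder inequality [E V ^ t <= e ^ r (E V ^ (t / 2)) ^ 2].
    For [t < 2 beta] the rate [r] is at most [1 / 4], and since [V <= 1 / 10] with
    probability at least [1 / 2], the Cauchy-Schwarz inequality forces
    [E V ^ t <= 1].  Along the halvings from [p] down to [beta, 2 beta) the ratios
    [r / t] decay geometrically like [(t / p) ^ (alpha - 1)], which is where the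
    factor [1 / (alpha - 1)] of [L] comes from; they add up to
    [E V ^ p <= e ^ (p / 4)].  The same for [- f] bounds the [p]-th moment of
    [|f - m| / M], and Markov's inequality together with [|E f - m| <= 3 e M]
    concludes. *)

(** * Means and entropies of bounded functions *)

Section bounded_integrals.
Context d (T : measurableType d) (R : realType) (P : probability T R).
Implicit Types g h : T -> R.

Definition bounded_measurable g :=
  measurable_fun setT g /\ exists M, forall x, `|g x| <= M.

Lemma bounded_measurable_integrable g :
  bounded_measurable g -> P.-integrable setT (EFin \o g).
Proof.
move=> [mg [M gM]]; apply: measurable_bounded_integrable => //.
  by apply: le_lt_trans (probability_le1 P _) _; rewrite ?ltry.
exists M; split; first exact: num_real.
by move=> y My x _; exact: le_trans (gM x) (ltW My).
Qed.

Lemma bounded_measurable_cst (c : R) : bounded_measurable (fun=> c).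
Proof. by split => //; exists `|c|. Qed.

Lemma bounded_measurableD g h : bounded_measurable g -> bounded_measurable h ->
  bounded_measurable (fun x => g x + h x).
Proof.
move=> [mg [M gM]] [mh [N hN]]; split; first exact: measurable_funD.
by exists (M + N) => x; rewrite (le_trans (ler_normD _ _))// lerD.
Qed.

Lemma bounded_measurableM g h : bounded_measurable g -> bounded_measurable h ->
  bounded_measurable (fun x => g x * h x).
Proof.
move=> [mg [M gM]] [mh [N hN]]; split; first exact: measurable_funM.
by exists (M * N) => x; rewrite normrM ler_pM.
Qed.

Lemma bounded_measurableZ (c : R) g : bounded_measurable g ->
  bounded_measurable (fun x => c * g x).
Proof. exact/bounded_measurableM/bounded_measurable_cst. Qed.

Lemma bounded_measurable_indic (A : set T) : measurable A ->
  bounded_measurable \1_A.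
Proof.
move=> mA; split; first exact: measurable_indic.
by exists 1 => x; rewrite indicE; case: (_ \in _); rewrite ?normr1 ?normr0.
Qed.

Lemma mean_cst (c : R) : \int[P]_x c = c.
Proof.
rewrite Rintegral_cst// -[RHS]mulr1; congr (c * _).
rewrite -[RHS]/(fine 1%E); congr fine.
exact: probability_setT.
Qed.

Lemma meanD g h : bounded_measurable g -> bounded_measurable h ->
  \int[P]_x (g x + h x) = \int[P]_x g x + \int[P]_x h x.
Proof. by move=> bg bh; rewrite RintegralD//; exact: bounded_measurable_integrable. Qed.

Lemma meanZ (c : R) g : bounded_measurable g ->
  \int[P]_x (c * g x) = c * \int[P]_x g x.
Proof. by move=> bg; rewrite RintegralZl//; exact: bounded_measurable_integrable. Qed.

Lemma mean_indic (A : set T) : measurable A -> \int[P]_x \1_A x = fine (P A).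
Proof. by move=> mA; rewrite /Rintegral integral_indic// setIT. Qed.

Lemma le_mean g h : bounded_measurable g -> bounded_measurable h ->
  (forall x, g x <= h x) -> \int[P]_x g x <= \int[P]_x h x.
Proof.
by move=> bg bh gh; apply: le_Rintegral => //; exact: bounded_measurable_integrable.
Qed.

Lemma mean_ge0 g : (forall x, 0 <= g x) -> 0 <= \int[P]_x g x.
Proof. by move=> g0; exact: Rintegral_ge0. Qed.

Lemma EFin_mean g : bounded_measurable g ->
  (\int[P]_x (g x)%:E)%E = (\int[P]_x g x)%:E.
Proof.
move=> bg; rewrite fineK//; apply: integrable_fin_num => //.
exact: bounded_measurable_integrable.
Qed.

Lemma ln_le_subr1 (y : R) : 0 < y -> ln y <= y - 1.
Proof.
by move=> y0; rewrite -[in ln y](subrKC 1 y) le_ln1Dx//; lra.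
Qed.

Lemma xlnx_ge_subr1 (x : R) : 0 < x -> x - 1 <= x * ln x.
Proof.
move=> x0; have := ln_le_subr1 (y := x^-1); rewrite invr_gt0 => /(_ x0).
rewrite lnV ?posrE// -(ler_pM2l x0) mulrBr divff ?gt_eqF// mulrN; lra.
Qed.

Lemma bounded_measurable_xlnx g : bounded_measurable g -> (forall x, 0 < g x) ->
  bounded_measurable (fun x => g x * ln (g x)).
Proof.
move=> [mg [M gM]] g0; split.
  by apply: measurable_funM => //; apply: measurableT_comp => //; exact: measurable_ln.
exists (1 + M ^+ 2) => x.
have gx := g0 x; have := gM x; rewrite gtr0_norm// => gxM.
have l : ln (g x) <= g x - 1.
  exact: ln_le_subr1.
have u : g x * ln (g x) <= g x * (g x - 1) by rewrite ler_pM2l.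
have := xlnx_ge_subr1 gx; rewrite ler_norml => b; apply/andP; split; nra.
Qed.

(* Jensen's inequality for [exp] under the law with density [h ^+ 2 / s ^+ 2],
   in the form of the tangent of [exp] at [- r / 2]. *)
Lemma mean_ge_of_entropy_le h (r s : R) :
  bounded_measurable h -> (forall x, 0 < h x) -> 0 < s ->
  \int[P]_x (h x ^+ 2) = s ^+ 2 ->
  \int[P]_x (h x ^+ 2 * ln (h x ^+ 2)) - s ^+ 2 * ln (s ^+ 2) <= r * s ^+ 2 ->
  expR (- (r / 2)) * s <= \int[P]_x h x.
Proof.
move=> bh h0 s0 q ent.
have bh2 : bounded_measurable (fun x => h x ^+ 2) by exact: bounded_measurableM.
have bl : bounded_measurable (fun x => h x ^+ 2 * ln (h x ^+ 2)).
  by apply: bounded_measurable_xlnx => // x; rewrite exprn_gt0.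
(* Since [h = h ^+ 2 * expR (ln s - ln h) / s], the tangent bounds [h] below by
   [k * h ^+ 2 * (a - ln h)], with equality where [ln s - ln h = - (r / 2)]. *)
pose k := expR (- (r / 2)) / s.
have k0 : 0 < k by rewrite divr_gt0 ?expR_gt0.
pose a := 1 + r / 2 + ln s.
have pw x : k * a * h x ^+ 2 + - (k / 2) * (h x ^+ 2 * ln (h x ^+ 2)) <= h x.
  have hx := h0 x.
  rewrite lnXn// -[ln _ *+ 2]mulr_natl.
  have -> : k * a * h x ^+ 2 + - (k / 2) * (h x ^+ 2 * (2%:R * ln (h x))) =
    h x * ((h x / s) * expR (- (r / 2)) * (1 + (r / 2 + ln s - ln (h x)))).
    by rewrite /k /a; field; rewrite gt_eqF.
  rewrite -[leRHS]mulr1 ler_pM2l//.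
  have := expR_ge1Dx (r / 2 + ln s - ln (h x)); set z := _ - ln (h x) => ez.
  have e1 : (h x / s) * expR (- (r / 2)) * expR z = 1.
    rewrite -mulrA -expRD /z.
    have -> : - (r / 2) + (r / 2 + ln s - ln (h x)) = ln s - ln (h x) by ring.
    by rewrite expRB !lnK ?posrE// mulrA divfK ?gt_eqF// divff// gt_eqF.
  by rewrite -[leRHS]e1 ler_pM2l// mulr_gt0 ?divr_gt0// expR_gt0.
have bka : bounded_measurable (fun x => k * a * h x ^+ 2) by exact: bounded_measurableZ.
have bkl := bounded_measurableZ (- (k / 2)) bl.
have /le_trans : expR (- (r / 2)) * s <=
    \int[P]_x (k * a * h x ^+ 2 + - (k / 2) * (h x ^+ 2 * ln (h x ^+ 2))).
  rewrite meanD// !meanZ// q.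
  have -> : expR (- (r / 2)) * s = k * s ^+ 2 by rewrite /k; field; rewrite gt_eqF.
  move: ent; set I := \int[P]_x _; rewrite lnXn// -[ln _ *+ 2]mulr_natl /a => ent.
  rewrite -subr_ge0.
  have -> : k * (1 + r / 2 + ln s) * s ^+ 2 + - (k / 2) * I - k * s ^+ 2 =
    k / 2 * (r * s ^+ 2 - (I - s ^+ 2 * (2%:R * ln s))) by field.
  by rewrite mulr_ge0 ?subr_ge0// divr_ge0// ltW.
apply; apply: le_mean => //; exact: bounded_measurableD.
Qed.

(** By Cauchy-Schwarz the part of the mean over [A] is at most [s * sqrt (P A)], and [17 / 24] is a
    rational upper bound of [1 / sqrt 2]. The part off [A] is at most [1 / 10]. *)
Lemma mean_le_of_small_off h (A : set T) (s : R) :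
  measurable A -> (P A <= (2^-1)%:E)%E ->
  bounded_measurable h -> (forall x, 0 <= h x) ->
  (forall x, ~ A x -> h x <= 10^-1) -> 0 < s ->
  \int[P]_x (h x ^+ 2) = s ^+ 2 ->
  \int[P]_x h x <= 10^-1 + 17 / 24 * s.
Proof.
move=> mA PA bh h0 hA s0 q.
have bh2 : bounded_measurable (fun x => h x ^+ 2) by exact: bounded_measurableM.
have bA := bounded_measurable_indic mA.
(* AM-GM on [A]; the coefficients are such that [7 / 20 + 5 / 14 < 17 / 24]. *)
have pw x : h x <= 10^-1 + (7 / (20 * s) * h x ^+ 2 + 5 * s / 7 * \1_A x).
  rewrite indicE; case: (boolP (x \in A)) => [_|].
    have -> : 7 / (20 * s) * h x ^+ 2 + 5 * s / 7 * true%:R =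
      h x + 7 / (20 * s) * (h x - 10 * s / 7) ^+ 2 by rewrite /=; field; rewrite gt_eqF.
    have : 0 <= 7 / (20 * s) * (h x - 10 * s / 7) ^+ 2.
      by rewrite mulr_ge0 ?sqr_ge0// divr_ge0// mulr_ge0// ltW.
    lra.
  rewrite notin_setE => /hA hx; rewrite /= mulr0 addr0.
  have : 0 <= 7 / (20 * s) * h x ^+ 2.
    by rewrite mulr_ge0 ?sqr_ge0// divr_ge0// mulr_ge0// ltW.
  lra.
have b1 : bounded_measurable (fun x =>
  7 / (20 * s) * h x ^+ 2) by exact: bounded_measurableZ.
have b2 : bounded_measurable (fun x =>
  5 * s / 7 * \1_A x) by exact: bounded_measurableZ.
have b3 := bounded_measurableD b1 b2.
have bc := bounded_measurable_cst 10^-1.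
apply: (le_trans (le_mean bh (bounded_measurableD bc b3) pw)).
rewrite meanD// mean_cst meanD// !meanZ// q mean_indic//.
have PA2 : fine (P A) <= 2^-1.
  by rewrite -lee_fin fineK// fin_num_measure.
have : 5 * s / 7 * fine (P A) <= 5 * s / 7 * 2^-1.
  by rewrite ler_pM2l// divr_gt0// mulr_gt0.
have -> : 7 / (20 * s) * s ^+ 2 = 7 / 20 * s by field; rewrite gt_eqF.
by move=> ?; lra.
Qed.

End bounded_integrals.

(** * Lower integrals of nonnegative functions *)

(* [integral] of a nonnegative function that is not measurable is a lower
   integral, which is only superadditive in general. *)
Lemma le_lower_integralD d (T : measurableType d) (R : realType)
    (mu : {measure set T -> \bar R}) (H G W : T -> R) :
  (forall x, 0 <= H x) -> (forall x, 0 <= G x) -> (forall x, 0 <= W x) ->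
  measurable_fun setT W -> (forall x, H x <= G x + W x) ->
  (\int[mu]_x (H x)%:E <= \int[mu]_x (G x)%:E + \int[mu]_x (W x)%:E)%E.
Proof.
move=> H0 G0 W0 mW HGW.
rewrite ge0_integralTE//.
apply/ereal_supP => _ /= [h hH <-].
(* For a simple function [h <= H], the positive part of [h - W] is measurable and lies below [G], so
   its integral is at most the lower integral of [G]. As [h <= k + W] with both terms measurable,
   additivity applies. *)
pose k x := Num.max (h x - W x) 0.
have mh : measurable_fun setT h by exact: measurable_funPT.
have mk : measurable_fun setT k by apply: measurable_funrpos; exact: measurable_funB.
have k0 x : 0 <= k x by rewrite /k le_max lexx orbT.
have kG : (\int[mu]_x (k x)%:E <= \int[mu]_x (G x)%:E)%E.
  rewrite [leLHS]ge0_integralTE; last by move=> x; rewrite lee_fin.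
  rewrite [leRHS]ge0_integralTE; last by move=> x; rewrite lee_fin.
  apply/ereal_supP => _ /= [g gk <-]; apply: ereal_sup_ubound.
  exists g => //= x; apply: le_trans (gk x) _; rewrite lee_fin /k ge_max G0 andbT.
  by have := hH x; rewrite lee_fin => ?; have := HGW x; lra.
rewrite -integralT_nnsfun.
apply: (@le_trans _ _ (\int[mu]_x ((k x)%:E + (W x)%:E))%E).
  apply: ge0_le_integral => //.
  - by move=> x _; rewrite lee_fin.
  - exact/measurable_EFinP.
  - by apply/measurable_EFinP; exact: measurable_funD.
  - by move=> x _; rewrite lee_fin /k -lerBlDr le_max lexx.
rewrite ge0_integralD//.
- exact: leeD.
- by move=> x _; rewrite lee_fin.
- exact/measurable_EFinP.
- by move=> x _; rewrite lee_fin.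
- exact/measurable_EFinP.
Qed.

(** Dividing a simple function below [k * G] by [k] gives a simple function below [G], whose
    integral is at most the lower integral of [G]. *)
Lemma lower_integralZl d (T : measurableType d) (R : realType)
    (mu : {measure set T -> \bar R}) (G : T -> R) (k : R) :
  (forall x, 0 <= G x) -> 0 < k ->
  (\int[mu]_x (k * G x)%:E <= k%:E * \int[mu]_x (G x)%:E)%E.
Proof.
move=> G0 k0.
rewrite ge0_integralTE; last by move=> x; rewrite lee_fin mulr_ge0// ltW.
apply/ereal_supP => _ /= [h hH <-].
have mh : measurable_fun setT h by exact: measurable_funPT.
rewrite -lee_pdivrMl// -integralT_nnsfun -ge0_integralZl//=.
- rewrite [leLHS]ge0_integralTE; last first.
    by move=> x; rewrite -EFinM lee_fin mulr_ge0// invr_ge0 ltW.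
  rewrite [leRHS]ge0_integralTE; last by move=> x; rewrite lee_fin.
  apply/ereal_supP => _ /= [g gk <-]; apply: ereal_sup_ubound.
  exists g => //= x; apply: le_trans (gk x) _.
  by rewrite -EFinM lee_fin ler_pdivrMl//; have := hH x; rewrite lee_fin.
- exact/measurable_EFinP.
- by move=> x _; rewrite lee_fin.
- by rewrite lee_fin invr_ge0 ltW.
Qed.

(** * Locally Lipschitz functions and the chain rule for [grad] *)

Lemma locally_lipschitzP (R : realType) (n : nat) (f : 'rV[R]_n -> R) :
  locally_lipschitz f <->
  forall x : 'rV[R]_n, exists2 U, nbhs x U &
    exists k, forall y z, U y -> U z -> `|f y - f z| <= k * `|y - z|.
Proof.
split=> lf x; have [U xU] := lf x.
(* The Lipschitz notation asserts the bound for every constant above some [M], so [M + 1] serves. *)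
- move=> [M [Mr /(_ (M + 1))]]; rewrite ltrDl ltr01 => /(_ isT) h.
  exists U => //; exists (M + 1) => y z Uy Uz.
  exact: (h (y, z)).
- move=> [k fk]; exists U => //; exists k; split; first exact: num_real.
  move=> M kM [y z] [/= Uy Uz]; apply: le_trans (fk _ _ Uy Uz) _.
  by rewrite ler_wpM2r// ltW.
Qed.

Lemma locally_lipschitz_continuous (R : realType) (n : nat) (f : 'rV[R]_n -> R) :
  locally_lipschitz f -> continuous f.
Proof.
move=> /locally_lipschitzP lf x; have [U xU [k fk]] := lf x.
apply/(@cvgrPdist_lt _ _ _ (nbhs x) (nbhs_filter x)) => e e0.
have k0 : 0 < `|k| + 1 by rewrite ltr_wpDl.
have r0 : 0 < e / (`|k| + 1) by rewrite divr_gt0.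
have UV : nbhs x (U `&` ball x (e / (`|k| + 1))).
  by apply: (@filterI _ _ (nbhs_filter x)) => //; exact: nbhsx_ballx.
apply: (@filterS _ _ (nbhs_filter x) _ _ _ UV) => y [Uy].
rewrite -ball_normE /= => yx.
apply: le_lt_trans (fk _ _ (nbhs_singleton xU) Uy) _.
apply: (@le_lt_trans _ _ ((`|k| + 1) * `|x - y|)).
  by rewrite ler_wpM2r// (le_trans (ler_norm k))// lerDl.
by rewrite mulrC -ltr_pdivlMr.
Qed.

Lemma locally_lipschitz_comp (R : realType) (n : nat) (g : R -> R)
    (f : 'rV[R]_n -> R) (B : R) :
  (forall a b, `|g a - g b| <= B * `|a - b|) ->
  locally_lipschitz f -> locally_lipschitz (g \o f).
Proof.
move=> gB /locally_lipschitzP lf; apply/locally_lipschitzP => x.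
have [U xU [k fk]] := lf x; exists U => //; exists (`|B| * k) => y z Uy Uz /=.
rewrite (le_trans (gB _ _))// (@le_trans _ _ (`|B| * `|f y - f z|))//.
  by rewrite ler_wpM2r// ler_norm.
by rewrite -mulrA ler_wpM2l// fk.
Qed.

Lemma lipschitz_of_derive_le (R : realType) (g dg : R -> R) (B : R) :
  (forall w : R, is_derive w 1 g (dg w)) -> (forall w, `|dg w| <= B) ->
  forall a b, `|g a - g b| <= B * `|a - b|.
Proof.
move=> gd dB.
have cg : continuous g.
  move=> w; apply: differentiable_continuous; apply/derivable1_diffP.
  by have [] := gd w.
have H a b : a <= b -> `|g b - g a| <= B * `|b - a|.
  move=> ab; have [c _ ->] := MVT_segment ab (fun x _ =>
    gd x) (continuous_subspaceT cg).
  by rewrite normrM ler_wpM2r.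
move=> a b; have [ab|/ltW ba] := leP a b; last exact: H.
by rewrite distrC [X in _ * X]distrC H.
Qed.

Lemma continuous_measurable_rV (R : realType) (n : nat) (f : 'rV[R]_n -> R) :
  continuous f -> measurable_fun setT f.
Proof.
move=> /continuousP cf; apply: (measurability _ (RGenOpens.measurableE R)).
move=> _ [_ [a [b ->] <-]]; rewrite setTI; apply: sub_sigma_algebra.
exact/cf/interval_open.
Qed.

(* By Caratheodory's form of the derivative the difference quotients of
   [g \o f] are those of [f] times factors tending to [a]; as [a != 0], either
   both converge or both have the junk limit [0]. *)
Lemma derive_comp_neq0 (R : realType) (n : nat) (g : R -> R)
    (f : 'rV[R]_n -> R) (x v : 'rV[R]_n) (a : R) :
  {for x, continuous f} -> is_derive (f x) 1 g a -> a != 0 ->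
  derive (g \o f : 'rV[R]_n -> R^o) x v =
  a * derive (f : 'rV[R]_n -> R^o) x v.
Proof.
move=> cf [gd ga] a0.
pose b := f x.
pose phi y := if y == b then a else (g y - g b) / (y - b).
have phiE y : g y - g b = phi y * (y - b).
  rewrite /phi; case: eqVneq => [->|yb]; first by rewrite !subrr mulr0.
  by rewrite divfK// subr_eq0.
have cphi : phi y @[y --> b] --> a.
  have ga' : h^-1 *: (g (h *: 1 + b) - g b) @[h --> 0^'] --> a.
    by rewrite -ga; exact: gd.
  apply/cvgrPdist_lt => e e0.
  move/cvgrPdist_lt : ga' => /(_ e e0) /nbhs_ballP[r /= r0 hr].
  apply/nbhs_ballP; exists r => //= y ry.
  rewrite /phi; case: eqVneq => [_|yb]; first by rewrite subrr normr0.
  have := hr (y - b); rewrite /ball /= sub0r normrN distrC in ry *.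
  move=> /(_ ry); rewrite subr_eq0 => /(_ yb).
  by rewrite /GRing.scale/= mulr1 subrK mulrC.
pose q h := h^-1 *: ((f \o shift x) (h *: v) - f x) : R^o.
pose Q h := h^-1 *: ((g \o f \o shift x) (h *: v) - g (f x)) : R^o.
pose c h := phi (f (h *: v + x)).
have QE h : Q h = c h * q h.
  by rewrite /Q /q /c /= phiE /GRing.scale/= mulrCA.
have cc : c h @[h --> 0^'] --> a.
  apply: cvg_within_filter.
  have cfx : f (h *: v + x) @[h --> (0 : R)] --> b.
    have : h *: v + x @[h --> (0 : R)] --> x.
      rewrite -[X in _ --> X]add0r -(scale0r v).
      by apply: cvgD; [apply: cvgZr_tmp; exact: cvg_id|exact: cvg_cst].
    by move=> /(cvg_comp _ _); apply; exact: cf.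
  exact: (cvg_comp _ _ cfx cphi).
rewrite /derive -/q -/Q.
have QqC l : q h @[h --> 0^'] --> l -> Q h @[h --> 0^'] --> a * l.
  move=> ql; have -> : Q = fun h => c h * q h by apply/funext.
  exact: cvgM cc ql.
have [qc|qd] := pselect (cvg (q h @[h --> 0^'])).
  exact/cvg_lim/QqC.
rewrite (dvgP qd) [LHS]dvgP ?mulr0// => Qc; apply: qd;
  apply: (@cvgP _ _ (a^-1 * lim (Q h @[h --> 0^']))).
have : (c h)^-1 * Q h @[h --> 0^'] --> a^-1 * lim (Q h @[h --> 0^']).
  by apply: cvgM => //; exact: cvgV.
apply: cvg_trans; apply: near_eq_cvg.
have : \forall h \near 0^', c h != 0.
  exact: (cvgr_neq0 _ cc a0).
by apply: filterS => h c0; rewrite QE mulKf.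
Qed.

Lemma grad_comp (R : realType) (n : nat) (g : R -> R)
    (f : 'rV[R]_n -> R) (x : 'rV[R]_n) (a : R) :
  {for x, continuous f} -> is_derive (f x) 1 g a -> a != 0 ->
  grad (g \o f) x = a *: grad f x.
Proof.
by move=> cf gd a0; apply/rowP => i; rewrite !mxE; exact: derive_comp_neq0.
Qed.

Lemma gradN (R : realType) (n : nat) (f : 'rV[R]_n -> R) (x : 'rV[R]_n) :
  {for x, continuous f} -> grad (fun y => - f y) x = - grad f x.
Proof.
move=> cf; rewrite -scaleN1r; apply: (grad_comp (g := -%R)) => //.
Qed.

(** * A smooth positive truncation on the real line *)

(* The slope [10] makes [softpos w <= 1 / 10] for [w <= 0].  [softclip] replaces
   the truncated positive part because it is positive, so that its powers are
   admissible in [mLSI], and its derivative does not vanish, so that the chain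
   rule for [grad] also holds where [f] is not differentiable. *)
Definition softpos (R : realType) (w : R) : R := 10^-1 * ln (1 + expR (10 * w)).

Definition softclip (R : realType) (N w : R) : R := softpos w - softpos (w - N).

Definition sigmoid (R : realType) (w : R) : R :=
  expR (10 * w) / (1 + expR (10 * w)).

Section softclip.
Context (R : realType).
Implicit Types N w : R.

Let onee w : 0 < 1 + expR (10 * w) :> R.
Proof. by rewrite ltr_pwDl// expR_ge0. Qed.

Lemma is_derive_softpos w : is_derive w 1 (@softpos R) (sigmoid w).
Proof.
have e1 : is_derive w 1 (fun z : R => 10 * z) 10.
  by apply: is_derive_eq; rewrite /GRing.scale/= mulr1.
have e2 : is_derive w 1 (fun z : R => expR (10 * z)) (expR (10 * w) * 10).
  exact: (is_derive1_comp (f := expR) (g := fun z : R => 10 * z)).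

have e3 : is_derive w 1 (fun z : R => 1 + expR (10 * z)) (expR (10 * w) * 10).
  rewrite -[X in is_derive _ _ _ X]add0r.
  exact: (is_deriveD (is_derive_cst (1 : R) w 1) e2).
have e4 : is_derive w 1 (fun z : R => ln (1 + expR (10 * z)))
    ((1 + expR (10 * w))^-1 * (expR (10 * w) * 10)).
  by apply: (@is_derive1_comp _ (@ln R)) => //; exact: is_derive1_ln.
have e5 : is_derive w 1 (fun z : R => 10^-1 * ln (1 + expR (10 * z)))
    (10^-1 * ((1 + expR (10 * w))^-1 * (expR (10 * w) * 10))).
  exact: (is_deriveZ 10^-1 e4).
apply: is_derive_eq; rewrite /sigmoid; field.
by rewrite gt_eqF.
Qed.

Lemma is_derive_softclip N w :
  is_derive w 1 (softclip N) (sigmoid w - sigmoid (w - N)).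
Proof.
have e1 : is_derive w 1 (fun z : R => z - N) 1.
  rewrite -[X in is_derive _ _ _ X]subr0.
  exact: (is_deriveB (is_derive_id w 1) (is_derive_cst N w 1)).
have e2 : is_derive w 1 (fun z : R => softpos (z - N)) (sigmoid (w - N) * 1).
  exact: (is_derive1_comp (g := fun z : R => z - N) (is_derive_softpos _) e1).
rewrite mulr1 in e2.
exact: (is_deriveB (is_derive_softpos w) e2).
Qed.

Lemma sigmoidE w : sigmoid w = 1 - (1 + expR (10 * w))^-1.
Proof. by rewrite /sigmoid; field; rewrite gt_eqF. Qed.

(** [sigmoid] is strictly increasing with values in []0, 1[]. Positivity is what [grad_comp] asks
    for, and the bound by [1] keeps the logarithmic gradient of the truncation under control. *)
Lemma softclip_derive_itv N w : 0 < N ->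
  0 < sigmoid w - sigmoid (w - N) <= 1.
Proof.
move=> N0; rewrite !sigmoidE.
have lt : (1 + expR (10 * w))^-1 < (1 + expR (10 * (w - N)))^-1 :> R.
  by rewrite ltf_pV2 ?posrE// ltrD2l ltr_expR; lra.
have le1 : (1 + expR (10 * (w - N)))^-1 <= 1 :> R.
  by rewrite invf_le1// lerDl expR_ge0.
have : 0 < (1 + expR (10 * w))^-1 :> R by rewrite invr_gt0.
by move=> ?; apply/andP; split; lra.
Qed.

Lemma softpos_gt0 w : 0 < softpos w.
Proof. by rewrite mulr_gt0// ln_gt0// ltrDl expR_gt0. Qed.

Lemma softclip_gt0 N w : 0 < N -> 0 < softclip N w.
Proof.
move=> N0; rewrite subr_gt0 ltr_pM2l// ltr_ln ?posrE// ltrD2l ltr_expR; lra.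
Qed.

(** Puts the constant under the logarithm, so that bounds on [softclip] become inequalities between
    exponentials. *)
Lemma softpos_shift (c w : R) :
  c + softpos w = 10^-1 * ln (expR (10 * c) * (1 + expR (10 * w))).
Proof. by rewrite lnM ?posrE ?expR_gt0// expRK /softpos; field. Qed.

Lemma softclip_le N w : 0 <= N -> softclip N w <= N.
Proof.
move=> N0; rewrite lerBlDr softpos_shift ler_pM2l//.
rewrite ler_ln ?posrE ?mulr_gt0 ?expR_gt0// mulrDr mulr1 -expRD.
have -> : 10 * N + 10 * (w - N) = 10 * w by ring.
by rewrite lerD2r -[leLHS]expR0 ler_expR mulr_ge0.
Qed.

Lemma softclip_le_inv10 N w : w <= 0 -> softclip N w <= 10^-1.
Proof.
move=> w0; rewrite /softclip lerBlDr (@le_trans _ _ 10^-1)//.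
  (* For [w <= 0] the argument of the logarithm is at most [2 <= expR 1]. *)
  rewrite /softpos ler_piMr// -[leRHS](expRK 1) ler_ln ?posrE ?expR_gt0//.
  have := expR_ge1Dx (1 : R).
  have : expR (10 * w) <= 1 by rewrite -[leRHS]expR0 ler_expR; lra.
  lra.
by rewrite lerDl ltW// softpos_gt0.
Qed.

(** After exponentiation the claim is [expR (10 * w + 10 * (w - N)) <= 1], that is [2 * w <= N]. *)
Lemma le_softclip N w : w <= N / 2 -> w <= softclip N w.
Proof.
move=> wN.
rewrite lerBrDr softpos_shift ler_pM2l//.
rewrite ler_ln ?posrE ?mulr_gt0 ?expR_gt0// mulrDr mulr1 -expRD addrC lerD2r.
by rewrite -[leRHS]expR0 ler_expR; lra.
Qed.

End softclip.

(** * Bounds on [Psi] in terms of the quasi-norm *)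

Section quasinorm.
Context (R : realType) (n : nat) (Psi : 'rV[R]_n -> R) (K alpha beta : R).
Hypotheses (CPsi : condition_C Psi) (GPsi : growth_condition Psi K alpha beta).
Hypotheses (alpha0 : 0 < alpha) (beta0 : 0 < beta) (K1 : 1 <= K).
Implicit Types (z : 'rV[R]_n) (p a c : R).

Let K0 : 0 < K. Proof. exact: lt_le_trans K1. Qed.

Lemma Psi_ge0 z : 0 <= Psi z.
Proof.
have [[P0 _] Pgt _ _ _] := CPsi.
by have [->|/Pgt/ltW//] := eqVneq z 0; rewrite P0.
Qed.

Lemma quasinorm_ge0 p z : 0 <= quasinorm Psi p z.
Proof.
rewrite /quasinorm; set A := [set a | _].
have [A0|A0] := pselect (A !=set0); last by rewrite inf_out// => -[].
by apply: lb_le_inf => // a [/ltW].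
Qed.

Lemma quasinormN p z : quasinorm Psi p (- z) = quasinorm Psi p z.
Proof.
have [_ _ _ _ [_ Psym]] := CPsi.
rewrite /quasinorm /Psi_scaled; congr inf; apply/seteqP.
by split=> a /= [a0]; rewrite !scalerN -?Psym => h; split; rewrite ?scalerN -?Psym.
Qed.

(** Continuity of [Psi] at [0] makes every large [a] admissible. This excludes the default value [0]
    that [inf] takes on the empty set. *)
Lemma quasinorm_set_nonempty p z : 0 < p ->
  [set a | 0 < a /\ Psi_scaled Psi p (a^-1 *: z) <= 1] !=set0.
Proof.
move=> p0; have [[P0 Pc] _ _ _ _] := CPsi.
have cz : Psi (p *: (s *: z)) @[s --> (0 : R)] --> (0 : R).
  have : p *: (s *: z) @[s --> (0 : R)] --> (0 : 'rV[R]_n).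
    rewrite -[X in _ --> X](scaler0 _ p) -(scale0r z).
    by apply: cvgZl_tmp; apply: cvgZr_tmp; exact: cvg_id.
  move=> pz0; have Pc0 : Psi y @[y --> (0 : 'rV[R]_n)] --> (0 : R).
    by have := Pc; rewrite /prop_for /continuous_at P0.
  exact: (cvg_comp _ _ pz0 Pc0).
move/cvgrPdist_lt : cz => /(_ p p0) /nbhs_ballP[r /= r0 hr].
exists (r / 2)^-1; split; first by rewrite invr_gt0 divr_gt0.
rewrite /Psi_scaled invrK ler_pdivrMl// mulr1.
have := hr (r / 2); rewrite /ball /= sub0r normrN gtr0_norm ?divr_gt0// => /(_ _).
rewrite sub0r normrN ger0_norm ?Psi_ge0// => h; apply/ltW/h.
by rewrite ltr_pdivrMr// ltr_pMr// ltrDl.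
Qed.

(** By (C3) there is [r] with [Psi > p] outside the ball of radius [r], so an admissible [a]
    satisfies [p * |z| / a <= r], which bounds it away from [0]. *)
Lemma quasinorm_gt0 p z : 0 < p -> z != 0 -> 0 < quasinorm Psi p z.
Proof.
move=> p0 z0; have [_ _ Pinf _ _] := CPsi; have [r hr] := Pinf p.
have nz : 0 < `|z| by rewrite normr_gt0.
have r0 : 0 < `|r| + 1 by rewrite ltr_wpDl.
have b0 : 0 < p * `|z| / (`|r| + 1) by rewrite divr_gt0// mulr_gt0.
apply: (lt_le_trans b0); apply: lb_le_inf; first exact: quasinorm_set_nonempty.
move=> a [a0]; rewrite /Psi_scaled ler_pdivrMl// mulr1 scalerA => h.
rewrite ler_pdivrMr// -ler_pdivrMl// mulrC mulrAC.
have := hr ((p / a) *: z); rewrite normrZ gtr0_norm ?divr_gt0// => hra.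
have [|/hra] := leP (p / a * `|z|) r; last by rewrite ltNge h.
by have := ler_norm r; lra.
Qed.

(** For [c >= 1] this is the upper growth bound at [z], with exponent [beta]. For [c <= 1] it is the
    lower growth bound at [c *: z] with the factor [c^-1], which gives exponent [alpha]. The sum
    covers both cases. *)
Lemma Psi_le_of_scaled_le z c p : 0 < p -> 0 <= c -> Psi z <= p ->
  Psi (c *: z) <= K * p * (c `^ alpha + c `^ beta).
Proof.
move=> p0 c0 Pz; have [[P0 _] Pgt _ _ _] := CPsi.
have rhs0 : 0 <= K * p * (c `^ alpha + c `^ beta).
  by rewrite mulr_ge0 ?addr_ge0 ?powR_ge0// mulr_ge0// ltW.
have [->|z0] := eqVneq z 0; first by rewrite scaler0 P0.
have [c00|cn0] := eqVneq c 0; first by rewrite {1}c00 scale0r P0.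
have cp : 0 < c by rewrite lt_neqAle eq_sym cn0.
have [c1|/ltW c1] := leP 1 c.
  have /andP[_] := GPsi z0 c1; rewrite ler_pdivrMr ?Pgt// => h.
  apply: (le_trans h); apply: (@le_trans _ _ (K * c `^ beta * p)).
    by rewrite ler_wpM2l// mulr_ge0 ?powR_ge0// ltW.
  rewrite -[leRHS]mulrA [p * _]mulrC -mulrA ler_pM2l// ler_pM2r//.
  by rewrite lerDr powR_ge0.
have cz0 : c *: z != 0 by rewrite scaler_eq0 negb_or cn0.
have ci1 : 1 <= c^-1 by rewrite invf_ge1.
have /andP[+ _] := GPsi cz0 ci1.
rewrite scalerA mulVf// scale1r ler_pdivlMr ?Pgt// => h.
have ca : 0 < c `^ alpha by rewrite powR_gt0.
apply: (@le_trans _ _ (K * c `^ alpha * p)).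
  move: h; have -> : c^-1 `^ alpha = (c `^ alpha)^-1.
    by rewrite -(powR_inv1 (ltW cp)) -powRrM mulN1r powRN.
  rewrite -invfM ler_pdivrMl ?mulr_gt0// => /le_trans; apply.
  by rewrite ler_wpM2l// mulr_ge0// ltW.
rewrite -[leRHS]mulrA [p * _]mulrC -mulrA ler_pM2l// ler_pM2r//.
by rewrite lerDl powR_ge0.
Qed.

(** The factor [2] leaves room for an admissible [a] below twice the positive infimum; then [c *: z]
    is [c * a / p] times the point [p *: (a^-1 *: z)], where [Psi <= p]. *)
Lemma Psi_le_quasinorm z c p : 0 < p -> 0 <= c ->
  Psi (c *: z) <= K * p * ((2 * c * quasinorm Psi p z / p) `^ alpha
                         + (2 * c * quasinorm Psi p z / p) `^ beta).
Proof.
move=> p0 c0; have [[P0 _] _ _ _ _] := CPsi.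
have [->|z0] := eqVneq z 0.
  rewrite scaler0 P0 mulr_ge0 ?addr_ge0 ?powR_ge0//.
  by rewrite mulr_ge0// ltW.
have F0 := quasinorm_gt0 p0 z0; set F := quasinorm _ _ _ in F0 *.
have [a [a0]] : exists2 a, [set a | 0 < a /\ Psi_scaled Psi p (a^-1 *: z) <= 1] a & a
  < 2 * F.
  apply: inf_lt; first exact: quasinorm_set_nonempty.
  by rewrite -/(quasinorm _ _ _) -/F; lra.
rewrite /Psi_scaled ler_pdivrMl// mulr1 => Pa aF.
have -> : c *: z = (c * a / p) *: (p *: (a^-1 *: z)).
  by rewrite !scalerA; congr (_ *: _); field; rewrite !gt_eqF.
have ca0 : 0 <= c * a / p by rewrite divr_ge0 ?mulr_ge0// ltW.
apply: (le_trans (Psi_le_of_scaled_le p0 ca0 Pa)).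
have le1 : c * a / p <= 2 * c * F / p.
  by rewrite ler_pM2r ?invr_gt0// -mulrA mulrCA ler_wpM2l// ltW.
by rewrite ler_pM2l ?mulr_gt0// lerD// ge0_ler_powR ?nnegrE ?(le_trans ca0 le1)// ltW.
Qed.

End quasinorm.

(** * Pointwise bound on the energy density *)

Lemma powR_le1 (R : realType) (x g : R) : 0 <= x -> x <= 1 -> 0 <= g ->
  x `^ g <= 1.
Proof.
move=> x0 x1 g0; have -> : 1 = 1 `^ g :> R by rewrite powR1.
by rewrite ge0_ler_powR ?nnegrE.
Qed.

(** If [u <= v], the power of the ratio is at most [1]; otherwise raising its exponent from [g] to
    [t] increases it. This separates the gradient [u] from the truncated function [v], as Young's
    inequality would. *)
Lemma powR_ratio_le (R : realType) (u v g t : R) : 0 <= u -> 0 < v -> 0 <= g -> g <=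
  t ->
  (u / v) `^ g * v `^ t <= u `^ t + v `^ t.
Proof.
move=> u0 v0 g0 gt; have uv0 : 0 <= u / v by rewrite divr_ge0// ltW.
have [uv|/ltW vu] := leP u v.
  apply: (@le_trans _ _ (v `^ t)); last by rewrite lerDr powR_ge0.
  rewrite ler_piMl ?powR_ge0// powR_le1//.
  by rewrite ler_pdivrMr// mul1r.
apply: (@le_trans _ _ (u `^ t)); last by rewrite lerDl powR_ge0.
have -> : u `^ t = (u / v) `^ t * v `^ t.
  by rewrite -powRM ?(ltW v0)// divfK// gt_eqF.
by rewrite ler_pM2r ?powR_gt0// ler_powR// ler_pdivlMr// mul1r.
Qed.

Lemma powR_le_1D (R : realType) (u t p : R) : 0 <= u -> 0 <= t -> t <= p ->
  u `^ t <= 1 + u `^ p.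
Proof.
move=> u0 t0 tp; have [u1|/ltW u1] := leP u 1.
  apply: (@le_trans _ _ 1); last by rewrite lerDl powR_ge0.
  exact: powR_le1.
by apply: (le_trans (ler_powR u1 tp)); rewrite lerDr.
Qed.

(* Here [z] stands for [grad f], [v] for the truncated function, and [c *: z] for
   the logarithmic gradient of [v `^ (t / 2)]. *)
Lemma energy_density_le (R : realType) (n : nat) (Psi : 'rV[R]_n -> R)
    (K alpha beta p t Phi kappa v c : R) (z : 'rV[R]_n) :
  condition_C Psi -> growth_condition Psi K alpha beta ->
  0 < alpha -> alpha <= beta -> 1 <= K -> 0 < p -> beta <= t -> t <= p ->
  0 < Phi -> 0 < kappa -> 0 < v -> 0 <= c -> c <= t / (2 * (kappa * Phi) * v) ->
  Psi (c *: z) * v `^ t <=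
    K * p * ((t / p / kappa) `^ alpha + (t / p / kappa) `^ beta) *
    (1 + (quasinorm Psi p z / Phi) `^ p + v `^ t).
Proof.
move=> CP GP a0 ab K1 p0 bt tp Ph0 k0 v0 c0 cle.
have b0 := lt_le_trans a0 ab; have t0 := lt_le_trans b0 bt.
have K0 : 0 < K by exact: lt_le_trans K1.
have F0 := quasinorm_ge0 Psi p z; set F := quasinorm _ _ _ in F0 *.
have u0 : 0 <= F / Phi by rewrite divr_ge0// ltW.
have y0 : 0 <= 2 * c * F / p by rewrite divr_ge0 ?mulr_ge0// ltW.
have q0 : 0 <= t / p / kappa by rewrite !divr_ge0// ltW.
(* The [2] in the bound on [c], which stems from the exponent [t / 2], cancels the [2] of
   [Psi_le_quasinorm]. *)
have le1 : 2 * c * F / p <= t / p / kappa * (F / Phi / v).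
  have -> : t / p / kappa * (F / Phi / v) = 2 * (t / (2 * (kappa * Phi) * v)) * F / p.
    by field; rewrite !gt_eqF.
  by rewrite ler_pM2r ?invr_gt0// ler_wpM2r// ler_pM2l.
(* Used for [g = alpha] and [g = beta], both at most [t]. After [powR_ratio_le] the gradient carries
   exponent [t], which [powR_le_1D] raises to [p], where [normf] will control it. *)
have bound g : 0 < g -> g <= t ->
    (2 * c * F / p) `^ g * v `^ t <=
    (t / p / kappa) `^ g * (1 + (F / Phi) `^ p + v `^ t).
  move=> g0 gt.
  apply: (@le_trans _ _ ((t / p / kappa * (F / Phi / v)) `^ g * v `^ t)).
    rewrite ler_wpM2r ?powR_ge0// ge0_ler_powR ?nnegrE ?(ltW g0)//.
    exact: le_trans le1.
  rewrite powRM//; last by rewrite divr_ge0 ?(ltW v0).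
  rewrite -mulrA ler_wpM2l ?powR_ge0//.
  apply: (le_trans (powR_ratio_le u0 v0 (ltW g0) gt)).
  by rewrite lerD2r powR_le_1D// ltW.
apply: (@le_trans _ _ (K * p * ((2 * c * F / p) `^ alpha
                         + (2 * c * F / p) `^ beta) * v `^ t)).
  by rewrite ler_wpM2r ?powR_ge0// Psi_le_quasinorm.
rewrite -[leLHS]mulrA -[leRHS]mulrA ler_pM2l ?mulr_gt0//.
rewrite mulrDl [leRHS]mulrDl; apply: lerD; apply: bound => //.
exact: le_trans ab bt.
Qed.

(** * Entropy and energy of powers of the truncation *)

Section truncated_moments.
Context (R : realType) (n : nat) (Psi : 'rV[R]_n -> R).
Context (K D alpha beta p Phi kappa m N : R).
Context (mu : probability 'rV[R]_n R) (f : 'rV[R]_n -> R).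
Hypotheses (CPsi : condition_C Psi) (GPsi : growth_condition Psi K alpha beta).
Hypotheses (alpha0 : 0 < alpha) (alphabeta : alpha <= beta) (beta2 : 2 <= beta).
Hypotheses (K1 : 1 <= K) (D0 : 0 < D) (LSI : mLSI mu Psi D).
Hypotheses (Phi0 : 0 < Phi) (kappa0 : 0 < kappa) (N0 : 0 < N).
Hypothesis lipf : locally_lipschitz f.
Hypothesis normf :
  (\int[mu]_x ((quasinorm Psi p (grad f x) / Phi) `^ p)%:E <= 1)%E.

Let M := kappa * Phi.
Let M0 : 0 < M. Proof. exact: mulr_gt0. Qed.
Let beta0 : 0 < beta. Proof. by have := beta2; lra. Qed.
Let theta (y : R) := softclip N ((y - m) / M).

Definition truncation (x : 'rV[R]_n) : R := softclip N ((f x - m) / (kappa * Phi)).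

Definition truncated_moment (t : R) : R := \int[mu]_x (truncation x `^ t).

(** The factor [3] counts the terms [1], [(F / Phi) ^ p] and [V ^ t] of the density bound, each of
    mean at most [truncated_moment t] once that moment is at least [1]. *)
Definition entropy_rate (t : R) : R :=
  3 * D * K * p * ((t / p / kappa) `^ alpha + (t / p / kappa) `^ beta).

Lemma truncation_gt0 x : 0 < truncation x.
Proof. exact: softclip_gt0. Qed.

Lemma measurable_truncation : measurable_fun setT truncation.
Proof.
have cs : continuous (softclip N).
  move=> w; apply: differentiable_continuous; apply/derivable1_diffP.
  by have [] := is_derive_softclip N w.
apply: (measurableT_comp (continuous_measurable_fun cs)).
apply: measurable_funM => //; apply: measurable_funB => //.
by apply: continuous_measurable_rV; apply: locally_lipschitz_continuous; exact: lipf.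
Qed.

Lemma bounded_measurable_truncation_powR (t : R) : 0 <= t ->
  bounded_measurable (fun x => truncation x `^ t).
Proof.
move=> t0; split.
  exact: (measurableT_comp (measurable_powR t) measurable_truncation).
exists (N `^ t) => x; rewrite ger0_norm ?powR_ge0//.
by rewrite ge0_ler_powR ?nnegrE ?softclip_le// ltW// truncation_gt0.
Qed.

Let dtheta (s y : R) := s * theta y `^ (s - 1) *
  ((sigmoid ((y - m) / M) - sigmoid ((y - m) / M - N)) * M^-1).

Let is_derive_theta_powR (s y : R) : is_derive y 1 (fun y => theta y `^ s) (dtheta s y).
Proof.
have e1 : is_derive y 1 (fun y : R => (y - m) / M) M^-1.
  have -> : (fun z : R => (z - m) / M) = M^-1 \*: (id - cst m).
    by apply/funext => z /=; rewrite /GRing.scale/= mulrC.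
  apply: (is_derive_eq (is_deriveZ M^-1
    (is_deriveB (is_derive_id y 1) (is_derive_cst m y 1)))).
  by rewrite subr0 /GRing.scale/= mulr1.
have e2 := is_derive1_comp (g := fun y : R => (y - m) / M) (is_derive_softclip N _) e1.
exact: (is_derive1_comp (g := theta) (is_derive1_powR _ (softclip_gt0 _ N0)) e2).
Qed.

Let sigd y := sigmoid ((y - m) / M) - sigmoid ((y - m) / M - N).

(** For [s >= 1] the factor [theta y ^ (s - 1)] of the derivative is at most [N ^ (s - 1)]. With
    [s = t / 2] this is where [2 <= beta <= t] enters. *)
Let lipschitz_theta_powR (s : R) : 1 <= s ->
  locally_lipschitz (fun x => truncation x `^ s).
Proof.
move=> s1; have s0 : 0 <= s by exact: le_trans s1.
apply: (@locally_lipschitz_comp _ _ (fun y =>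
  theta y `^ s) f (s * N `^ (s - 1) / M)) => //.
apply: lipschitz_of_derive_le (is_derive_theta_powR s) _ => y.
have /andP[d0 d1] := softclip_derive_itv ((y - m) / M) N0.
have th0 : 0 < theta y by exact: softclip_gt0.
rewrite /dtheta ger0_norm; last first.
  by rewrite !mulr_ge0 ?powR_ge0 ?invr_ge0 ?(ltW d0) ?(ltW M0).
rewrite mulrA ler_pM2r ?invr_gt0// -[leRHS]mulr1 ler_pM ?(ltW d0)//.
  by rewrite mulr_ge0 ?powR_ge0.
have thN : theta y <= N by apply: softclip_le; exact: ltW.
by rewrite ler_wpM2l// ge0_ler_powR ?nnegrE ?(ltW th0) ?(ltW N0)// subr_ge0.
Qed.

Let grad_truncation_powR (s : R) x : 0 < s ->
  (truncation x `^ s)^-1 *: grad (fun x => truncation x `^ s) x =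
  (s * sigd (f x) / (M * truncation x)) *: grad f x.
Proof.
move=> s0; have /andP[d0 _] := softclip_derive_itv ((f x - m) / M) N0.
have th0 := truncation_gt0 x.
have dn0 : dtheta s (f x) != 0.
  by rewrite /dtheta gt_eqF// !mulr_gt0 ?powR_gt0 ?invr_gt0.
rewrite (@grad_comp _ _ (fun y =>
  theta y `^ s) f x _ _ (is_derive_theta_powR s (f x)))//; last first.
  exact: locally_lipschitz_continuous.
rewrite scalerA; congr (_ *: _); rewrite /dtheta -/(truncation x) -/(sigd (f x)).
have -> : theta (f x) = truncation x by [].
have -> : truncation x `^ s = truncation x * truncation x `^ (s - 1).
  by rewrite mulr_powRB1// ltW.
by field; rewrite !gt_eqF// powR_gt0.
Qed.

Lemma truncation_powR_half t x :
  (truncation x `^ (t / 2)) ^+ 2 = truncation x `^ t.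
Proof. by rewrite -powR_mulrn ?powR_ge0// -powRrM divfK. Qed.

(** The density bound splits into [k * G], which carries the gradient and is handled as a lower
    integral bounded through [normf], and the bounded measurable function [W]. *)
Lemma truncation_energy_le (t : R) : beta <= t -> t <= p -> 1 <= truncated_moment t ->
  ('E_mu[fun x => (Psi ((truncation x `^ (t / 2))^-1 *:
     grad (fun x => truncation x `^ (t / 2)) x) *
       (truncation x `^ (t / 2)) ^+ 2)%R] <=
   (3 * K * p * ((t / p / kappa) `^ alpha + (t / p / kappa) `^ beta) *
    truncated_moment t)%:E)%E.
Proof.
move=> bt tp q1.
have t0 : 0 < t by exact: lt_le_trans bt.
have p0 : 0 < p by exact: lt_le_trans tp.
have K0 : 0 < K by exact: lt_le_trans K1.
have r0 : 0 < t / p / kappa by rewrite !divr_gt0.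
pose k := K * p * ((t / p / kappa) `^ alpha + (t / p / kappa) `^ beta).
have k0 : 0 < k by rewrite !mulr_gt0// addr_gt0// powR_gt0.
pose G x := (quasinorm Psi p (grad f x) / Phi) `^ p.
pose W x := k * (1 + truncation x `^ t).
have bW : bounded_measurable W.
  apply/bounded_measurableZ/bounded_measurableD; first exact: bounded_measurable_cst.
  by apply: bounded_measurable_truncation_powR; exact: ltW.
have W0 x : 0 <= W x by rewrite mulr_ge0 ?addr_ge0 ?powR_ge0 ?(ltW k0).
have G0 x : 0 <= G x by exact: powR_ge0.
rewrite unlock; apply: (le_trans (le_lower_integralD (G := fun x =>
  k * G x) (W := W) _ _ _ _ _ _)).
- by move=> x; rewrite mulr_ge0 ?sqr_ge0// (Psi_ge0 CPsi).
- by move=> x; rewrite mulr_ge0// ltW.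
- by [].
- by have [] := bW.
- move=> x; rewrite grad_truncation_powR ?divr_gt0// truncation_powR_half.
  have /andP[d0 d1] := softclip_derive_itv ((f x - m) / M) N0.
  have th0 := truncation_gt0 x.
  have den0 : 0 < 2 * (kappa * Phi) * truncation x by rewrite !mulr_gt0.
  have c0 : 0 <= t / 2 * sigd (f x) / (M * truncation x).
    by rewrite divr_ge0 ?mulr_ge0 ?divr_ge0 ?(ltW d0) ?(ltW M0) ?(ltW th0)// ltW.
  have cle : t / 2 * sigd (f x) / (M * truncation x) <= t / (2 * (kappa * Phi) *
    truncation x).
    have -> : t / 2 * sigd (f x) / (M * truncation x) =
       t / (2 * (kappa * Phi) * truncation x) * sigd (f x).
      by rewrite /M; field; rewrite !gt_eqF.
    by rewrite ler_piMr// divr_ge0// ltW.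
  have := energy_density_le (grad f x) CPsi GPsi alpha0 alphabeta K1 p0 bt tp Phi0
    kappa0 th0 c0 cle.
  by rewrite -/k /G /W; lra.
rewrite (EFin_mean mu bW).
have -> : \int[mu]_x W x = k * (1 + truncated_moment t).
  have bt' := bounded_measurable_truncation_powR (ltW t0).
  have b1 : @bounded_measurable _ _ R (fun _ : 'rV[R]_n =>
    1) by exact: bounded_measurable_cst.
  rewrite meanZ ?meanD ?mean_cst//; exact: bounded_measurableD.
have : (\int[mu]_x (k * G x)%:E <= k%:E)%E.
  apply: (le_trans (lower_integralZl _ _ _)) => //.
  by rewrite -[leRHS]mule1 lee_pmul2l.
move=> /(leeD2r (k * (1 + truncated_moment t))%:E) /le_trans; apply.
rewrite -EFinD lee_fin.
have -> : 3 * K * p * ((t / p / kappa) `^ alpha + (t / p / kappa) `^ beta) *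
   truncated_moment t = k * (3 * truncated_moment t) by rewrite /k; ring.
by rewrite -[X in X + _]mulr1 -mulrDr ler_pM2l//; lra.
Qed.

(** [mLSI] applied to [h = V ^ (t / 2)] bounds the entropy of [h ^+ 2 = V ^ t], and
    [mean_ge_of_entropy_le] with [s] the root of the moment concludes. *)
Lemma truncated_moment_half (t : R) : beta <= t -> t <= p -> 1 <= truncated_moment t ->
  expR (- (entropy_rate t / 2)) * Num.sqrt (truncated_moment t) <=
  truncated_moment (t / 2).
Proof.
move=> bt tp q1.
have t2 : 2 <= t by exact: le_trans bt.
have t0 : 0 < t by lra.
have h1 : 1 <= t / 2 by lra.
pose h x := truncation x `^ (t / 2).
have bh : bounded_measurable h by apply: bounded_measurable_truncation_powR; lra.
have h0 x : 0 < h x by rewrite powR_gt0// truncation_gt0.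
have bh2 : bounded_measurable (fun x => h x ^+ 2) by exact: bounded_measurableM.
have bl : bounded_measurable (fun x => h x ^+ 2 * ln (h x ^+ 2)).
  by apply: bounded_measurable_xlnx => // x; rewrite exprn_gt0.
have q : \int[mu]_x (h x ^+ 2) = truncated_moment t.
  by rewrite /truncated_moment; congr Rintegral; apply/funext => x;
    exact: truncation_powR_half.
have q0 : 0 < truncated_moment t by exact: lt_le_trans q1.
have sq : Num.sqrt (truncated_moment t) ^+ 2 = truncated_moment t by rewrite
  sqr_sqrtr// ltW.
have bdh : [bounded (h x : R^o) | x in setT].
  have [_ [B hB]] := bh; exists B; split; first exact: num_real.
  by move=> y By x _; exact: le_trans (hB x) (ltW By).
have := LSI h0 bdh (lipschitz_theta_powR h1).
rewrite /Ent !unlock (EFin_mean mu bl) (EFin_mean mu bh2) q lne_EFin// -EFinM -EFinB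
  => lsi.
apply: mean_ge_of_entropy_le => //; rewrite ?sqrtr_gt0 ?sq//.
rewrite -lee_fin (le_trans lsi)//.
have E := truncation_energy_le bt tp q1; rewrite unlock in E.
apply: (le_trans (lee_wpmul2l _ E)); first by rewrite lee_fin ltW.
by rewrite -EFinM lee_fin /entropy_rate !mulrA [3 * D]mulrC.
Qed.

End truncated_moments.

(** * Numerical bounds on the entropy rate *)

Lemma Lconst_gt0 (R : realType) (K D alpha beta : R) :
  1 < alpha -> 0 < beta -> 0 < K * D -> 0 < Lconst K D alpha beta.
Proof.
move=> a1 b0 X0; have a0 : 0 < (alpha - 1)^-1 by rewrite invr_gt0 subr_gt0.
by rewrite /Lconst addr_gt0 ?mulr_gt0 ?addr_gt0 ?powR_gt0.
Qed.

Section constants.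
Context (R : realType) (K D alpha beta : R).
Hypotheses (a1 : 1 < alpha) (a2 : alpha <= 2) (b2 : 2 <= beta).
Hypothesis X0 : 0 < K * D.

(** Large enough for [12 / c0] and [15 / c0] to be at most [1 / 4], and for
    [beta * c0 <= c0 ^ beta]. *)
Let c0 : R := expR 6.
Let L := Lconst K D alpha beta.
Let kappa := c0 * L.

Let alpha0 : 0 < alpha. Proof. by have := a1; lra. Qed.
Let beta0 : 0 < beta. Proof. by have := b2; lra. Qed.
Let am0 : 0 < alpha - 1. Proof. by rewrite subr_gt0. Qed.
Let L0 : 0 < L. Proof. exact: Lconst_gt0. Qed.

Lemma expR6_ge64 : 64 <= expR 6 :> R.
Proof.
have e2 : 2 <= expR 1 :> R by have := expR_ge1Dx (1 : R); lra.
rewrite -[6]mulr1 expRM_natl; apply: (@le_trans _ _ (2 ^+ 6));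
  last by rewrite lerXn2r ?nnegrE ?expR_ge0.
by rewrite -natrX.
Qed.

Let c0_ge1 : 1 <= c0. Proof. by rewrite -expR0 ler_expR. Qed.
Let c0_gt0 : 0 < c0. Proof. exact: expR_gt0. Qed.

Let powR_root (y e : R) : 0 < y -> e != 0 -> (y `^ e^-1) `^ e = y.
Proof. by move=> y0 e0; rewrite -powRrM mulVf// powRr1// ltW. Qed.

Let powR_scaled_ge (b e y : R) : 0 < b -> 0 < y -> 0 < e ->
  b * y `^ e^-1 <= L -> b `^ e * y <= L `^ e.
Proof.
move=> bb y0 e0 h; have p0 := powR_ge0 y e^-1.
rewrite -[in leLHS](powR_root y0 (lt0r_neq0 e0)) -powRM ?(ltW bb)//.
by rewrite ge0_ler_powR ?nnegrE ?mulr_ge0 ?(ltW bb) ?(ltW e0) ?(ltW L0).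
Qed.

Let L_terms : [/\ (alpha - 1)^-1 * (K * D) `^ beta^-1 <= L,
  (alpha - 1)^-1 * (K * D) `^ alpha^-1 <= L &
  beta `^ alpha^-1 * (K * D) `^ alpha^-1 <= L].
Proof.
have h0 : 0 <= (alpha - 1)^-1 by rewrite invr_ge0 ltW.
have t1 : 0 <= (alpha - 1)^-1 * (K * D) `^ beta^-1 by rewrite mulr_ge0 ?powR_ge0.
have t2 : 0 <= (alpha - 1)^-1 * (K * D) `^ alpha^-1 by rewrite mulr_ge0 ?powR_ge0.
have t3 : 0 <= beta `^ alpha^-1 * (K * D) `^ alpha^-1 by rewrite mulr_ge0 ?powR_ge0.
by rewrite /L /Lconst mulrDl; split; lra.
Qed.

Let am_inv1 : 1 <= (alpha - 1)^-1.
Proof. by rewrite invf_ge1// lerBlDr; have := a2; lra. Qed.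

Let kappa_powR (e : R) : kappa `^ e = c0 `^ e * L `^ e.
Proof. by rewrite powRM ?ltW. Qed.

(** Raise [(alpha - 1)^-1 * (K * D) ^ (1 / alpha) <= L] to the power [alpha]; since [(alpha - 1)^-1]
    and [c0] are at least [1], their powers dominate their first powers. The factor [alpha - 1]
    gained here pays for the geometric sum over the halvings. *)
Lemma KD_le_alpha : K * D / kappa `^ alpha <= (alpha - 1) / c0.
Proof.
have [_ h _] := L_terms.
have h1 := powR_scaled_ge (lt_le_trans ltr01 am_inv1) X0 alpha0 h.
have h2 : (alpha - 1)^-1 <= (alpha - 1)^-1 `^ alpha by apply: le1r_powR => //;
  exact: ltW.
have h3 : c0 <= c0 `^ alpha by apply: le1r_powR => //; exact: ltW.
rewrite ler_pdivrMr ?powR_gt0 ?mulr_gt0// kappa_powR.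
apply: (@le_trans _ _ ((alpha - 1) / c0 * (c0 * L `^ alpha))).
  rewrite mulrA divfK ?gt_eqF// -ler_pdivrMl//; apply: le_trans h1.
  by rewrite ler_pM2r.
by rewrite ler_pM2l ?divr_gt0// ler_pM2r ?powR_gt0.
Qed.

(** Comes from the term of [L] with [beta ^ (1 / alpha)]; the factor [1 / beta] makes the rate small
    for [t] of order [beta]. *)
Lemma KD_le_alpha_beta : K * D / kappa `^ alpha <= 1 / (beta * c0).
Proof.
have [_ _ h] := L_terms.
have bp : 0 < beta `^ alpha^-1 by rewrite powR_gt0.
have h1 := powR_scaled_ge bp X0 alpha0 h.
rewrite powR_root ?lt0r_neq0// in h1.
have h3 : c0 <= c0 `^ alpha by apply: le1r_powR => //; exact: ltW.
rewrite ler_pdivlMr ?mulr_gt0// mulrAC ler_pdivrMr ?powR_gt0 ?mulr_gt0// mul1r.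
rewrite kappa_powR mulrA mulrC; apply: ler_pM => //; first exact: ltW.
  by rewrite mulr_ge0 ?ltW.
by rewrite mulrC.
Qed.

(** The first term of [L] gives [K * D <= L ^ beta], and the factor [beta] is absorbed by
    [c0 ^ beta]. *)
Lemma KD_le_beta : K * D / kappa `^ beta <= 1 / (beta * c0).
Proof.
have [h _ _] := L_terms.
have h1 := powR_scaled_ge (lt_le_trans ltr01 am_inv1) X0 beta0 h.
have h2 : 1 <= (alpha - 1)^-1 `^ beta.
  apply: (le_trans am_inv1); apply: le1r_powR => //; have := b2; lra.
have h3 : beta * c0 <= c0 `^ beta.
  rewrite /powR gt_eqF// expRK.
  have -> : beta * 6 = 6 * (beta - 1) + 6 :> R by ring.
  rewrite expRD ler_pM2r ?expR_gt0//.
  by have := expR_ge1Dx (6 * (beta - 1)); have := b2; lra.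
rewrite ler_pdivlMr ?mulr_gt0// mulrAC ler_pdivrMr ?powR_gt0 ?mulr_gt0// mul1r.
rewrite kappa_powR mulrC; apply: ler_pM => //.
- by rewrite mulr_ge0 ?ltW.
- exact: ltW.
- by apply: le_trans h1; rewrite ler_peMl// ltW.
Qed.

Let rateE (p t : R) : 0 < p -> 0 < t ->
  entropy_rate K D alpha beta p kappa t =
  3 * t * (K * D / kappa `^ alpha * (t / p) `^ (alpha - 1) +
           K * D / kappa `^ beta * (t / p) `^ (beta - 1)).
Proof.
move=> p0 t0; have r0 : 0 < t / p by rewrite divr_gt0.
have k0 : 0 < kappa by rewrite mulr_gt0.
have E (e : R) : 0 < e ->
    (t / p / kappa) `^ e = t / p * (t / p) `^ (e - 1) / kappa `^ e.
  move=> e0; rewrite powRM ?invr_ge0 ?(ltW r0) ?(ltW k0)//.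
  rewrite -[kappa^-1]powR_inv1 ?(ltW k0)// -powRrM mulN1r powRN; congr (_ / _).
  by rewrite mulr_powRB1// ltW.
rewrite /entropy_rate !E//; field.
by rewrite !gt_eqF ?powR_gt0.
Qed.

(** As [t / p <= 1] and [beta - 1 >= 1], the power of [t / p] with exponent [beta - 1] is at most
    [t / p]. *)
Let rate_le (p t : R) : 0 < p -> 0 < t -> t <= p ->
  entropy_rate K D alpha beta p kappa t <=
  3 * t * (K * D / kappa `^ alpha * (t / p) `^ (alpha - 1) + (beta * c0)^-1 * (t / p)).
Proof.
move=> p0 t0 tp; rewrite rateE// ler_pM2l ?mulr_gt0// lerD2l.
have r0 : 0 < t / p by rewrite divr_gt0.
have r1 : t / p <= 1 by rewrite ler_pdivrMr// mul1r.
have k0 : 0 < kappa by rewrite mulr_gt0.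
apply: ler_pM; rewrite ?powR_ge0//.
- by rewrite divr_ge0 ?powR_ge0 ?(ltW X0).
- by have := KD_le_beta; rewrite mul1r.
- by rewrite ge1r_powR ?r0//; have := b2; lra.
Qed.

(** Both summands are at most [1 / (beta * c0)], and [beta] cancels against [t <= 2 * beta], which
    leaves [12 / c0]. *)
Lemma entropy_rate_base (p t : R) : 0 < p -> 0 < t -> t <= p -> t <= 2 * beta ->
  entropy_rate K D alpha beta p kappa t <= 4^-1.
Proof.
move=> p0 t0 tp tb; apply: (le_trans (rate_le p0 t0 tp)).
have r0 : 0 < t / p by rewrite divr_gt0.
have r1 : t / p <= 1 by rewrite ler_pdivrMr// mul1r.
have k0 : 0 < kappa by rewrite mulr_gt0.
have bc0 : 0 < (beta * c0)^-1 by rewrite invr_gt0 mulr_gt0.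
have s1 : K * D / kappa `^ alpha * (t / p) `^ (alpha - 1) <= (beta * c0)^-1.
  rewrite -[leRHS]mulr1; apply: ler_pM;
    rewrite ?powR_ge0 ?divr_ge0 ?(ltW X0) ?powR_ge0//.
    by have := KD_le_alpha_beta; rewrite mul1r.
  by rewrite powR_le1 ?(ltW r0) ?(ltW am0).
have s2 : (beta * c0)^-1 * (t / p) <= (beta * c0)^-1 by rewrite ler_piMr// ltW.
apply: (@le_trans _ _ (3 * (2 * beta) * (2 * (beta * c0)^-1))).
  apply: ler_pM => //; rewrite ?mulr_ge0 ?(ltW t0)//.
  - by rewrite addr_ge0// mulr_ge0 ?powR_ge0 ?(ltW bc0) ?(ltW r0)// divr_ge0
    ?powR_ge0 ?(ltW X0).
  - by rewrite ler_pM2l.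
  - lra.
have -> : 3 * (2 * beta) * (2 * (beta * c0)^-1) = 12 / c0 by field; rewrite !gt_eqF.
rewrite ler_pdivrMr//; have := expR6_ge64; rewrite -/c0; lra.
Qed.

(** A potential whose drop from [r] to [r / 2] dominates the rate divided by [t], where [r = t / p].
    By [half_powR] the coefficient [9] yields a drop of at least [3 * (alpha - 1) / c0] times the
    power of [r]; the coefficient [6] yields [3 / c0 * r]. *)
Definition growth_exponent (r : R) : R :=
  9 / c0 * r `^ (alpha - 1) + 6 / c0 * r.

Lemma growth_exponent_ge0 r : 0 <= r -> 0 <= growth_exponent r.
Proof. by move=> r0; rewrite addr_ge0// mulr_ge0 ?powR_ge0 ?divr_ge0 ?(ltW c0_gt0). Qed.

Lemma growth_exponent1 : growth_exponent 1 <= 4^-1.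
Proof.
rewrite /growth_exponent powR1 !mulr1 -mulrDl ler_pdivrMr//.
by have := expR6_ge64; rewrite -/c0; lra.
Qed.

(** With [x = alpha - 1], the bound [ln 2 >= 1 / 2] gives [2 ^ (- x) <= 1 / (1 + x / 2)], and
    [(1 + x / 2) * (1 - x / 3) >= 1] because [0 < x <= 1]. *)
Let half_powR : 2^-1 `^ (alpha - 1) <= 1 - (alpha - 1) / 3.
Proof.
have ln2 : 2^-1 <= - ln (2^-1) :> R.
  have := @ln_le_subr1 R 2^-1; rewrite invr_gt0 ltr0n => /(_ isT); lra.
rewrite /powR gt_eqF ?invr_gt0//.
set x := (alpha - 1) * _.
have xa : (alpha - 1) / 2 <= - x by rewrite /x -mulrN ler_pM2l.
have e : expR (- x) >= 1 + (alpha - 1) / 2.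
  by apply: le_trans (expR_ge1Dx _); lra.
rewrite -[x]opprK expRN.
have d0 : 0 < 1 + (alpha - 1) / 2 by have := am0; lra.
apply: (@le_trans _ _ (1 + (alpha - 1) / 2)^-1).
  by rewrite lef_pV2 ?posrE ?expR_gt0.
rewrite -[leLHS]mul1r ler_pdivrMr//; have := am0; have := a2; nra.
Qed.

Lemma entropy_rate_step (p t : R) : 0 < p -> 0 < t -> t <= p ->
  entropy_rate K D alpha beta p kappa t <=
  t * (growth_exponent (t / p) - growth_exponent (t / p / 2)).
Proof.
move=> p0 t0 tp; apply: (le_trans (rate_le p0 t0 tp)).
rewrite [3 * t]mulrC -[leLHS]mulrA ler_pM2l// /growth_exponent.
have r0 : 0 < t / p by rewrite divr_gt0.
rewrite [(t / p / 2) `^ _]powRM ?(ltW r0)//.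
set r := t / p in r0 *; have y0 := powR_ge0 r (alpha - 1); set y := r `^ _ in y0 *.
have h1 : K * D / kappa `^ alpha * y <= (alpha - 1) / c0 * y.
  by rewrite ler_wpM2r// KD_le_alpha.
have h2 : (beta * c0)^-1 * r <= c0^-1 * r.
  rewrite ler_pM2r// lef_pV2 ?posrE ?mulr_gt0// ler_peMl ?(ltW c0_gt0)//.
  by have := b2; lra.
have h3 : 9 / c0 * (y * 2^-1 `^ (alpha - 1)) <= 9 / c0 * (y * (1 - (alpha - 1) / 3)).
  by rewrite ler_pM2l ?divr_gt0// ler_wpM2l.
have -> : 9 / c0 * y + 6 / c0 * r - (9 / c0 * (y * 2^-1 `^ (alpha - 1)) + 6 / c0 * (r
  / 2)) =
  9 / c0 * y - 9 / c0 * (y * 2^-1 `^ (alpha - 1)) + 3 * (c0^-1 * r) by field;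
    rewrite gt_eqF.
have e3 : 9 / c0 * (y * (1 - (alpha - 1) / 3)) = 9 / c0 * y - 3 * ((alpha - 1) / c0 *
  y).
  by field; rewrite gt_eqF.
by rewrite mulrDr; lra.
Qed.

End constants.

(** * Induction along the halvings of the exponent *)

(** Squaring the reverse Hoelder inequality gives [A t <= expR (rate t) * A (t / 2) ^+ 2]; the bound
    at [t / 2] turns the exponent into [rate t + t * S (t / 2) <= t * S t]. Where [A t <= 1] the
    claim is immediate from [S t >= 0]. *)
Lemma dyadic_induction (R : realType) (A rate S : R -> R) (beta p : R) :
  0 < beta -> beta <= p ->
  (forall t, 0 <= A t) -> (forall t, 0 <= t -> 0 <= S t) ->
  (forall t, beta <= t -> t <= p -> 1 <= A t ->
     expR (- (rate t / 2)) * Num.sqrt (A t) <= A (t / 2)) ->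
  (forall t, beta <= t -> t <= p -> t < 2 * beta -> 1 < A t ->
     A (t / 2) <= 10^-1 + 17 / 24 * Num.sqrt (A t)) ->
  (forall t, beta <= t -> t <= p -> t < 2 * beta -> rate t <= 4^-1) ->
  (forall t, beta <= t -> t <= p -> rate t <= t * (S t - S (t / 2))) ->
  A p <= expR (p * S p).
Proof.
move=> b0 bp A0 S0 half base rbase rstep.
suff H k t : beta <= t -> t <= p -> t < 2 ^+ k * (2 * beta) -> A t <= expR (t * S t).
  (* [p / beta < k + 1 <= 2 ^ (k + 1)] puts [p] in the range of [H k]. *)
  pose k := Num.truncn (p / beta); apply: (H k) => //.
  have pk : p / beta < k.+1%:R by rewrite truncnS_gt.
  have k2 : k.+1%:R <= 2 ^+ k * 2 :> R.
    by rewrite -exprSr -natrX ler_nat ltnW// ltn_expl.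
  by rewrite mulrA -ltr_pdivrMr//; exact: lt_le_trans k2.
elim: k t => [|k IH] t bt tp tk.
  rewrite expr0 mul1r in tk; have t0 := lt_le_trans b0 bt.
  have e1 : 1 <= expR (t * S t) by rewrite -expR0 ler_expR mulr_ge0 ?S0 ?ltW.
  rewrite (le_trans _ e1)// leNgt; apply/negP => q1.
  have s1 : 1 < Num.sqrt (A t) by rewrite -[X in X < _]sqrtr1 ltr_sqrt// (lt_trans
    ltr01).
  have h := half _ bt tp (ltW q1); have b := base _ bt tp tk q1.
  (* A rate of at most [1 / 4] leaves a factor of at least [1 - 1 / 8]. With [s] the root of [A t],
     [h] and [b] give [7 / 8 * s <= 1 / 10 + 17 / 24 * s], that is [s <= 3 / 5], against [s > 1]. *)
  have e : 7 / 8 <= expR (- (rate t / 2)).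
    by apply: le_trans (expR_ge1Dx _); have := rbase _ bt tp tk; lra.
  have := ler_pM2r (lt_trans ltr01 s1) (7 / 8) (expR (- (rate t / 2))).
  rewrite e; lra.
have t0 := lt_le_trans b0 bt.
have [t2|t2] := ltP t (2 * beta).
  by apply: (IH t) => //; rewrite (lt_le_trans t2)// ler_peMl ?mulr_ge0 ?(ltW b0)//
    exprn_ege1// ler1n.
have e1 : 1 <= expR (t * S t) by rewrite -expR0 ler_expR mulr_ge0 ?S0 ?ltW.
have [q1|/ltW q1] := leP (A t) 1; first exact: le_trans e1.
have h := half _ bt tp q1.
have IHt : A (t / 2) <= expR (t / 2 * S (t / 2)).
  apply: IH; [lra|lra|].
  rewrite ltr_pdivrMr//; have -> : 2 ^+ k * (2 * beta) * 2 = 2 ^+ k.+1 * (2 * beta).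
    by rewrite exprS; ring.
  exact: tk.
have s0 := sqrtr_ge0 (A t).
have le1 : Num.sqrt (A t) <= expR (rate t / 2 + t / 2 * S (t / 2)).
  rewrite expRD -ler_pdivrMl ?expR_gt0// -expRN; exact: le_trans h IHt.
rewrite -(sqr_sqrtr (A0 t)).
apply: (@le_trans _ _ (expR (rate t / 2 + t / 2 * S (t / 2)) ^+ 2)).
  by rewrite lerXn2r ?nnegrE ?expR_ge0.
rewrite -expRM_natl ler_expR; have := rstep _ bt tp; lra.
Qed.

(** * The [p]-th moment of the truncation *)

Section truncated_moment_bound.
Context (R : realType) (n : nat) (Psi : 'rV[R]_n -> R).
Context (K D alpha beta p Phi m N : R).
Context (mu : probability 'rV[R]_n R) (f : 'rV[R]_n -> R).
Hypotheses (CPsi : condition_C Psi) (GPsi : growth_condition Psi K alpha beta).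
Hypotheses (a1 : 1 < alpha) (a2 : alpha <= 2) (b2 : 2 <= beta) (bp : beta <= p).
Hypotheses (K1 : 1 <= K) (D0 : 0 < D) (LSI : mLSI mu Psi D).
Hypotheses (Phi0 : 0 < Phi) (N0 : 0 < N).
Hypothesis lipf : locally_lipschitz f.
Hypothesis normf :
  (\int[mu]_x ((quasinorm Psi p (grad f x) / Phi) `^ p)%:E <= 1)%E.
Hypothesis medf : (mu [set x | (m < f x)%R] <= (2^-1)%:E)%E.

(** [dyadic_induction] with [S t = growth_exponent alpha (t / p)], whose value at [t = p] is at most
    [1 / 4]. Where [f <= m] the truncation is at most [1 / 10], hence so is its power [t / 2 >= 1];
    the median hypothesis bounds the remaining set. *)
Lemma truncated_moment_le :
  truncated_moment Phi (expR 6 * Lconst K D alpha beta) m N mu f p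
    <= expR (p / 4).
Proof.
move: (a1) (a2) (b2) (bp) (K1) => a1' a2' b2' bp' K1'.
have alpha0 : 0 < alpha by lra.
have ab : alpha <= beta by lra.
have beta0 : 0 < beta by lra.
have p0 : 0 < p by lra.
have X0 : 0 < K * D by rewrite mulr_gt0//; lra.
pose kappa := expR 6 * Lconst K D alpha beta.
have k0 : 0 < kappa by rewrite mulr_gt0 ?expR_gt0 ?Lconst_gt0.
rewrite -/kappa; set A := truncated_moment _ _ _ _ _ _.
pose rate := entropy_rate K D alpha beta p kappa.
pose S (t : R) := growth_exponent alpha (t / p).
apply: (@le_trans _ _ (expR (p * S p))); last first.
  by rewrite ler_expR ler_pM2l// /S divff ?gt_eqF// growth_exponent1.
apply: (@dyadic_induction _ A rate S beta) => //.
- by move=> t; apply: mean_ge0 => x; exact: powR_ge0.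
- by move=> t t0; rewrite growth_exponent_ge0 ?divr_ge0 ?(ltW p0).
- move=> t bt tp q1.
  exact: (truncated_moment_half CPsi GPsi alpha0 ab b2 K1 D0 LSI Phi0 k0 N0 lipf normf).
- move=> t bt tp t2 q1.
  have t0 : 0 < t by lra.
  have h2 x : (truncation Phi kappa m N f x `^ (t / 2)) ^+ 2 = truncation Phi kappa m
    N f x `^ t.
    exact: truncation_powR_half.
  have bh : bounded_measurable (fun x => truncation Phi kappa m N f x `^ (t / 2)).
    by apply: bounded_measurable_truncation_powR => //; lra.
  apply: (@mean_le_of_small_off _ _ _ mu _ [set x | m < f x]) => //.
  + have mf := continuous_measurable_rV (locally_lipschitz_continuous lipf).
    have -> : [set x | m < f x] = setT `&` f @^-1` `]m, +oo[%classic.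
      by apply/seteqP; split=> x /=; rewrite in_itv/= andbT// => -[].
    exact: mf.
  + by move=> x; exact: powR_ge0.
  + move=> x /negP; rewrite -leNgt => fm.
    have w0 : (f x - m) / (kappa * Phi) <= 0.
      have kP : 0 < kappa * Phi by exact: mulr_gt0.
      by rewrite (ler_pdivrMr _ _ kP) mul0r subr_le0.
    have V0 : 0 < truncation Phi kappa m N f x by exact: truncation_gt0.
    have V1 : truncation Phi kappa m N f x <= 10^-1 by exact: softclip_le_inv10.
    apply: (le_trans _ V1); apply: ge1r_powR; last by lra.
    by rewrite V0/=; lra.
  + by rewrite sqrtr_gt0; lra.
  + rewrite sqr_sqrtr; last by lra.
    by rewrite /A /truncated_moment; congr Rintegral; apply/funext.
- by move=> t bt tp t2; apply: entropy_rate_base => //; lra.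
- move=> t bt tp; rewrite /S.
  have -> : t / 2 / p = t / p / 2 by rewrite mulrAC.
  by apply: entropy_rate_step => //; lra.
Qed.

End truncated_moment_bound.

(** * Existence of a median *)

Lemma measure_bigcup_le d (T : measurableType d) (R : realType)
    (mu : {measure set T -> \bar R}) (F : (set T)^nat) (U : set T) (c : \bar R) :
  (forall i, measurable (F i)) -> nondecreasing_seq F -> \bigcup_i F i = U ->
  (forall i, mu (F i) <= c)%E -> (mu U <= c)%E.
Proof.
move=> mF ndF FU Fc.
have mU : measurable (\bigcup_i F i) by exact: bigcupT_measurable.
have := @nondecreasing_cvg_mu _ _ _ mu F mF mU ndF; rewrite FU => cv.
by apply: (cvge_to_le cv); apply: nearW => i; exact: Fc.
Qed.

Section median.
Context d (T : measurableType d) (R : realType) (P : probability T R).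
Context (f : T -> R) (mf : measurable_fun setT f).

Lemma measurable_ltfun (s : R) : measurable [set x | s < f x].
Proof.
have -> : [set x | s < f x] = setT `&` f @^-1` `]s, +oo[%classic.
  by apply/seteqP; split=> x /=; rewrite in_itv/= andbT// => -[].
exact: mf.
Qed.

Lemma measurable_funle (s : R) : measurable [set x | f x <= s].
Proof.
have -> : [set x | f x <= s] = setT `&` f @^-1` `]-oo, s]%classic.
  by apply/seteqP; split=> x /=; rewrite in_itv/=// => -[].
exact: mf.
Qed.

Let half_lt_setT : ~ (P setT <= (2^-1)%:E)%E.
Proof.
have -> : P setT = 1%E by exact: probability_setT.
by rewrite lee_fin; apply/negP; rewrite -ltNge invf_lt1// ltr1n.
Qed.

Let funle_gt_half s : ~ (P [set x | (s < f x)%R] <= (2^-1)%:E)%E ->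
  (P [set x | (f x <= s)%R] <= (2^-1)%:E)%E.
Proof.
move=> h.
have -> : [set x | f x <= s] = ~` [set x | s < f x].
  by apply/seteqP; split=> x /=; rewrite leNgt => /negP.
have mA := measurable_ltfun s.
rewrite probability_setC//.
have fA : P [set x | s < f x] \is a fin_num by rewrite fin_num_measure.
move: h; rewrite -(fineK fA) -EFinB !lee_fin => h.
by have : 2^-1 < fine (P [set x | s < f x]); [rewrite ltNge; exact/negP|lra].
Qed.

(** The median is the infimum of [A]. If [A] were empty or unbounded below, the events [f <= k],
    respectively [- k < f], would exhaust the space with measures at most [1 / 2]. Both bounds at
    the infimum follow by approaching the strict events from inside at distance [1 / (k + 1)]. *)
Lemma exists_median : exists m : R,
  (P [set x | (m < f x)%R] <= (2^-1)%:E)%E /\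
  (P [set x | (f x < m)%R] <= (2^-1)%:E)%E.
Proof.
pose A := [set s | (P [set x | (s < f x)%R] <= (2^-1)%:E)%E].
have Aup s t : A s -> s <= t -> A t.
  move=> As st; apply: le_trans As; apply: le_measure; rewrite ?inE//.
  - exact: measurable_ltfun.
  - exact: measurable_ltfun.
  - by move=> x /= tx; exact: le_lt_trans tx.
have A0 : A !=set0.
  apply: contrapT => /set0P/negP; rewrite negbK => /eqP Ae.
  apply: half_lt_setT.
  apply: (@measure_bigcup_le _ _ _ P (fun k => [set x | f x <= k%:R])).
  - by move=> k; exact: measurable_funle.
  - move=> k l kl; apply/subsetPset => x /= /le_trans; apply.
    by rewrite ler_nat.
  - apply/seteqP; split => // x _; exists (Num.bound `|f x|) => //=.
    exact: le_trans (ler_norm _) (ltW (archi_boundP (normr_ge0 _))).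
  - move=> k; apply: funle_gt_half => Ak.
    by have : A k%:R by []; rewrite Ae.
have Alb : has_lbound A.
  apply: contrapT => nlb; apply: half_lt_setT.
  apply: (@measure_bigcup_le _ _ _ P (fun k => [set x | - k%:R < f x])).
  - by move=> k; exact: measurable_ltfun.
  - move=> k l kl; apply/subsetPset => x /= h; apply: le_lt_trans h.
    by rewrite lerN2 ler_nat.
  - apply/seteqP; split => // x _; exists (Num.bound `|f x|) => //=.
    rewrite ltrNl; apply: le_lt_trans (archi_boundP (normr_ge0 _)).
    by rewrite -normrN ler_norm.
  - move=> k; apply: contrapT => Ak; apply: nlb; exists (- k%:R) => s As.
    by rewrite leNgt; apply/negP => /ltW /(Aup _ _ As).
exists (inf A); split.
- apply: (@measure_bigcup_le _ _ _ P (fun k => [set x | inf A + k.+1%:R^-1 < f x])).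
  + by move=> k; exact: measurable_ltfun.
  + move=> k l kl; apply/subsetPset => x /= h; apply: le_lt_trans h.
    by rewrite lerD2l lef_pV2 ?posrE// ler_nat.
  + apply/seteqP; split => x /=.
      by move=> [k _ /=]; apply: lt_trans; rewrite ltrDl.
    rewrite -subr_gt0 => /ltr_add_invr[k]; rewrite add0r => h; exists k => //=.
    by rewrite addrC -ltrBrDr.
  + move=> k; have [s As sk] : exists2 s, A s & s < inf A + k.+1%:R^-1.
      by apply: inf_lt => //; rewrite ltrDl.
    exact: Aup As (ltW sk).
- apply: (@measure_bigcup_le _ _ _ P (fun k => [set x | f x <= inf A - k.+1%:R^-1])).
  + by move=> k; exact: measurable_funle.
  + move=> k l kl; apply/subsetPset => x /= /le_trans; apply.
    by rewrite lerD2l lerN2 lef_pV2 ?posrE// ler_nat.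
  + apply/seteqP; split => x /=.
      by move=> [k _ /=] /le_lt_trans; apply; rewrite ltrBlDr ltrDl.
    rewrite -subr_gt0 => /ltr_add_invr[k]; rewrite add0r => h; exists k => //=.
    by rewrite lerBrDl -lerBrDr ltW.
  + move=> k; apply: funle_gt_half => Ak.
    have : inf A <= inf A - k.+1%:R^-1 by apply: ge_inf.
    by rewrite leNgt ltrBlDr ltrDl invr_gt0 ltr0n.
Qed.

End median.

(** * Removal of the truncation *)

Section moment_above_median.
Context (R : realType) (n : nat) (Psi : 'rV[R]_n -> R).
Context (K D alpha beta p Phi : R) (mu : probability 'rV[R]_n R).
Hypotheses (CPsi : condition_C Psi) (GPsi : growth_condition Psi K alpha beta).
Hypotheses (a1 : 1 < alpha) (a2 : alpha <= 2) (b2 : 2 <= beta) (bp : beta <= p).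
Hypotheses (K1 : 1 <= K) (D0 : 0 < D) (LSI : mLSI mu Psi D) (Phi0 : 0 < Phi).

Let M := expR 6 * Lconst K D alpha beta * Phi.

(** On [F k] the truncation at height [k + 1] dominates the positive part by [le_softclip]. The
    truncated bound is uniform in the height, so monotone convergence along [F] applies. *)
Lemma positive_part_moment_le (f : 'rV[R]_n -> R) (m : R) :
  locally_lipschitz f ->
  (\int[mu]_x ((quasinorm Psi p (grad f x) / Phi) `^ p)%:E <= 1)%E ->
  (mu [set x | (m < f x)%R] <= (2^-1)%:E)%E ->
  (\int[mu]_x (Num.max ((f x - m) / M) 0 `^ p)%:E <= (expR (p / 4))%:E)%E.
Proof.
move=> lipf normf medf.
have p0 : 0 < p by have := b2; have := bp; lra.
have mf := continuous_measurable_rV (locally_lipschitz_continuous lipf).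
pose g x := Num.max ((f x - m) / M) 0 `^ p.
pose w x := (f x - m) / M.
have mw : measurable_fun setT w by apply: measurable_funM => //; exact: measurable_funB.
have mg : measurable_fun setT g.
  apply: (measurableT_comp (measurable_powR p)).
  exact: (measurable_funrpos mw).
pose F k := [set x | w x <= k.+1%:R / 2].
have mF k : measurable (F k) by exact: measurable_funle.
have ndF : nondecreasing_seq F.
  move=> k l kl; apply/subsetPset => x; rewrite /F /= => /le_trans; apply.
  by rewrite ler_pM2r// ler_nat.
have FT : \bigcup_k F k = setT.
  apply/seteqP; split => // x _; exists (Num.bound `|2 * w x|) => //=.
  rewrite /F /= ler_pdivlMr// mulrC; apply: (le_trans (ler_norm _)).
  apply: (le_trans (ltW (archi_boundP (normr_ge0 _)))).
  by rewrite ler_nat.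
have cv := @ge0_nondecreasing_set_cvg_integral _ _ _ F (EFin \o g) mu ndF mF.
rewrite -[X in (\int[mu]_(x in X) _ <= _)%E]FT.
have mgF i : measurable_fun (F i) (EFin \o g).
  by apply/measurable_EFinP; exact: measurable_funTS.
have gF0 i x : F i x -> (0 <= (EFin \o g) x)%E by rewrite lee_fin powR_ge0.
apply: (cvge_to_le (cv mgF gF0)).
apply: nearW => k.
have N0 : 0 < k.+1%:R :> R by rewrite ltr0n.
have := truncated_moment_le CPsi GPsi a1 a2 b2 bp K1 D0 LSI Phi0 N0 lipf normf medf.
rewrite -lee_fin; apply: le_trans.
have alpha0 : 0 < alpha by have := a1; lra.
have beta0 : 0 < beta by have := b2; lra.
have X0 : 0 < K * D by rewrite mulr_gt0//; have := K1; lra.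
have M0 : 0 < expR 6 * Lconst K D alpha beta by rewrite mulr_gt0 ?expR_gt0 ?Lconst_gt0.
have bV : bounded_measurable
    (fun x => truncation Phi (expR 6 * Lconst K D alpha beta) m k.+1%:R f x `^ p).
  by apply: bounded_measurable_truncation_powR => //; exact: ltW.
rewrite /truncated_moment -(EFin_mean mu bV).
rewrite integral_mkcond; apply: ge0_le_integral => //.
- by move=> x _; rewrite erestrict_ge0// => y _; rewrite lee_fin powR_ge0.
- apply/(measurable_restrictT _ (mF k)); apply/measurable_EFinP;
  exact: measurable_funTS.
- by apply/measurable_EFinP; have [] := bV.
move=> x _; rewrite patchE; case: ifPn => [|_]; last by rewrite lee_fin powR_ge0.
rewrite inE /F /= => wN; rewrite lee_fin.
have V0 : 0 < truncation Phi (expR 6 * Lconst K D alpha beta) m k.+1%:R f x.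
  exact: truncation_gt0.
rewrite ge0_ler_powR ?nnegrE ?(ltW p0) ?(ltW V0)//.
  by rewrite le_max lexx orbT.
by rewrite ge_max (ltW V0) andbT; exact: le_softclip.
Qed.

(** The previous bound is applied to [f] at [m] and to [- f] at [- m]; by (C6) the gradients have
    the same quasi-norm. *)
Lemma central_moment_le (f : 'rV[R]_n -> R) (m : R) :
  locally_lipschitz f ->
  (\int[mu]_x ((quasinorm Psi p (grad f x) / Phi) `^ p)%:E <= 1)%E ->
  (mu [set x | (m < f x)%R] <= (2^-1)%:E)%E ->
  (mu [set x | (f x < m)%R] <= (2^-1)%:E)%E ->
  (\int[mu]_x ((`|f x - m| / M) `^ p)%:E <= (2 * expR (p / 4))%:E)%E.
Proof.
move=> lipf normf med1 med2.
have cf := locally_lipschitz_continuous lipf.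
have lipNf : locally_lipschitz (fun x => - f x).
  apply: (@locally_lipschitz_comp _ _ -%R f 1) => // a b.
  by rewrite mul1r -opprD normrN.
have normNf : (\int[mu]_x ((quasinorm Psi p (grad (fun y =>
  - f y) x) / Phi) `^ p)%:E <= 1)%E.
  have gN x : quasinorm Psi p (grad (fun y => - f y) x) = quasinorm Psi p (grad f x).
    by rewrite (gradN (cf x)); exact: (quasinormN CPsi).
  by under eq_integral do rewrite gN.
have medN : (mu [set x | (- m < - f x)%R] <= (2^-1)%:E)%E.
  by apply: le_trans med2; rewrite (_ : [set x | _] = [set x | f x < m])//;
    apply/seteqP; split=> x /=; rewrite ltrN2.
have p0 : 0 < p by have := b2; have := bp; lra.
have mf := continuous_measurable_rV cf.
have mpos (g : 'rV[R]_n -> R) : measurable_fun setT g ->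
    measurable_fun setT (fun x => (Num.max (g x) 0 `^ p)%:E).
  move=> mg; apply/measurable_EFinP; apply: (measurableT_comp (measurable_powR p)).
  exact: (measurable_funrpos mg).
have m1 : measurable_fun setT (fun x => (f x - m) / M).
  by apply: measurable_funM => //; exact: measurable_funB.
have m2 : measurable_fun setT (fun x => (- f x - - m) / M).
  apply: measurable_funM => //; apply: measurable_funB => //.
  exact: measurable_funN.
have := leeD (positive_part_moment_le lipf normf med1) (positive_part_moment_le lipNf
  normNf medN).
rewrite -EFinD -ge0_integralD//; last first.
- exact: (mpos _ m2).
- by move=> x _; rewrite lee_fin powR_ge0.
- exact: (mpos _ m1).
- by move=> x _; rewrite lee_fin powR_ge0.
have -> : expR (p / 4) + expR (p / 4) = 2 * expR (p / 4) by ring.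
apply: le_trans.
have X0 : 0 < K * D by rewrite mulr_gt0//; have := K1; lra.
have M0 : 0 < M.
  by rewrite /M mulr_gt0// mulr_gt0 ?expR_gt0 ?Lconst_gt0//; have := b2; lra.
apply: ge0_le_integral => //.
- by move=> x _; rewrite lee_fin powR_ge0.
- apply/measurable_EFinP; apply: (measurableT_comp (measurable_powR p)).
  apply: measurable_funM => //; apply: measurableT_comp => //; exact: measurable_funB.
- by apply: emeasurable_funD; [exact: mpos|exact: mpos].
move=> x _; rewrite -EFinD lee_fin.
have [fm|/ltW fm] := leP m (f x).
  have -> : Num.max ((f x - m) / M) 0 = `|f x - m| / M.
    by rewrite ger0_norm ?subr_ge0//; apply/max_idPl; rewrite divr_ge0 ?subr_ge0// ltW.
  by rewrite lerDl powR_ge0.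
have -> : Num.max ((- f x - - m) / M) 0 = `|f x - m| / M.
  rewrite -opprD mulNr distrC ger0_norm ?subr_ge0//; rewrite -mulNr opprB.
  by apply/max_idPl; rewrite divr_ge0 ?subr_ge0// ltW.
by rewrite lerDr powR_ge0.
Qed.

End moment_above_median.

(** * From the central moment to the deviation from the mean *)

Section deviation.
Context d (T : measurableType d) (R : realType) (P : probability T R).
Context (f : T -> R) (m M p : R).
Hypotheses (intf : P.-integrable setT (EFin \o f)) (M0 : 0 < M) (p2 : 2 <= p).
Hypothesis momf :
  (\int[P]_x ((`|f x - m| / M) `^ p)%:E <= (2 * expR (p / 4))%:E)%E.

Let mf : measurable_fun setT f.
Proof. by apply/measurable_EFinP; exact: measurable_int intf. Qed.

Let p0 : 0 < p. Proof. by have := p2; lra. Qed.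

Let mdev : measurable_fun setT (fun x => `|f x - m|).
Proof. by apply: measurableT_comp => //; exact: measurable_funB. Qed.

Let mmom : measurable_fun setT (fun x => (`|f x - m| / M) `^ p).
Proof.
have mq : measurable_fun setT (fun x => `|f x - m| / M) by exact: measurable_funM.
exact: (measurableT_comp (measurable_powR p) mq).
Qed.

Let probT : (\int[P]_x 1%:E = 1%:E)%E.
Proof. by rewrite integral_cst// mul1e; exact: probability_setT. Qed.

(** Integrate [y <= 1 + y ^ p] for [y = |f - m| / (e * M)]: the extra [e] in the scale turns the
    moment bound into [2 * expR (p / 4 - p) <= 2], so the total is [e * M * (1 + 2)]. *)
Lemma mean_dist_le : (\int[P]_x `|f x - m|%:E <= (3 * expR 1 * M)%:E)%E.
Proof.
have e0 := expR_gt0 (1 : R).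
have eM0 : 0 < expR 1 * M by rewrite mulr_gt0.
have ep0 := expR_gt0 (- p).
pose g x := (`|f x - m| / M) `^ p.
have g0 x : 0 <= g x by exact: powR_ge0.
have pw x : `|f x - m| <= expR 1 * M * (1 + expR (- p) * g x).
  rewrite -ler_pdivrMl//.
  have -> : expR (- p) * g x = ((expR 1 * M)^-1 * `|f x - m|) `^ p.
    have -> : (expR 1 * M)^-1 * `|f x - m| = expR (- 1) * (`|f x - m| / M).
      by rewrite expRN; field; rewrite !gt_eqF.
    rewrite powRM ?expR_ge0// ?divr_ge0 ?(ltW M0)//; congr (_ * _).
    by rewrite -expRM mulN1r.
  rewrite -[leLHS]powRr1 ?mulr_ge0 ?invr_ge0 ?(ltW eM0)//.
  by rewrite powR_le_1D ?mulr_ge0 ?invr_ge0 ?(ltW eM0)//; have := p2; lra.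
have mg1 : measurable_fun setT (fun x => 1 + expR (- p) * g x).
  by apply: measurable_funD => //; exact: measurable_funM.
apply: (@le_trans _ _ (\int[P]_x (expR 1 * M * (1 + expR (- p) * g x))%:E)%E).
  apply: ge0_le_integral => //.
  - exact/measurable_EFinP.
  - by apply/measurable_EFinP; exact: measurable_funM.
  - by move=> x _; rewrite lee_fin.
have -> : (\int[P]_x (expR 1 * M * (1 + expR (- p) * g x))%:E =
    (expR 1 * M)%:E * (1 + (expR (- p))%:E * \int[P]_x (g x)%:E))%E.
  under eq_integral do rewrite EFinM.
  rewrite ge0_integralZl//; first last.
  - by rewrite lee_fin ltW.
  - by move=> x _; rewrite lee_fin addr_ge0// mulr_ge0// ltW.
  - exact/measurable_EFinP.
  congr (_ * _)%E; under eq_integral do rewrite EFinD EFinM.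
  rewrite ge0_integralD//; first last.
  - by apply/measurable_EFinP; exact: measurable_funM.
  - by move=> x _; rewrite -EFinM lee_fin mulr_ge0// ltW.
  rewrite probT; congr (_ + _)%E.
  rewrite ge0_integralZl//; first last.
  - by move=> x _; rewrite lee_fin.
  - by apply/measurable_EFinP; exact: mmom.
have -> : 3 * expR 1 * M = expR 1 * M * 3 by ring.
rewrite [leRHS]EFinM lee_pmul2l ?lte_fin//.
have h : ((expR (- p))%:E * \int[P]_x (g x)%:E <= (expR (- p) * (2 * expR (p /
  4)))%:E)%E.
  by rewrite EFinM lee_pmul2l ?lte_fin.
apply: (le_trans (leeD2l _ h)); rewrite -EFinD lee_fin mulrCA -expRD.
have : expR (- p + p / 4) <= 1 by rewrite expR_le1; have := p0; lra.
lra.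
Qed.

Lemma dist_mean_median_le : (`|'E_P[f] - m%:E| <= (3 * expR 1 * M)%:E)%E.
Proof.
apply: le_trans mean_dist_le.
have -> : ('E_P[f] - m%:E = \int[P]_x (f x - m)%:E)%E.
  rewrite unlock; under [RHS]eq_integral do rewrite EFinB.
  have intm : (\int[P]_x m%:E = m%:E)%E.
    rewrite integral_cst// -[RHS]mule1; congr (_ * _)%E; exact: probability_setT.
  by rewrite integralB//= ?intm//; exact: finite_measure_integrable_cst.
apply: le_trans (le_abse_integral _ _ _) _ => //.
by apply/measurable_EFinP; exact: measurable_funB.
Qed.

(** By the triangle inequality the event forces [|f - m| >= expR 3 * M]. Markov's inequality bounds
    the probability of this by [2 * expR (p / 4 - 3 * p)], and [2 <= expR 1] with [p >= 2]
    finishes. *)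
Lemma deviation_le :
  (P [set x | ((expR 3 + 3 * expR 1) * M)%:E <= `|(f x)%:E - 'E_P[f]|]
    <= (expR (- p))%:E)%E.
Proof.
pose A := [set x | expR 3 * M <= `|f x - m|].
have mA : measurable A.
  have -> : A = setT `&` (fun x => `|f x - m|) @^-1` `[expR 3 * M, +oo[%classic.
    by apply/seteqP; split=> x /=; rewrite in_itv/= andbT// => -[].
  exact: mdev.
have Ef : 'E_P[f]%E \is a fin_num.
  by rewrite unlock; exact: (integrable_fin_num _ intf).
have mE : measurable [set x | ((expR 3 + 3 * expR 1) * M)%:E <= `|(f x)%:E -
  'E_P[f]|]%E.
  rewrite -(fineK Ef).
  have -> : [set x | (((expR 3 + 3 * expR 1) * M)%:E <= `|(f x)%:E - (fine
    'E_P[f]%E)%:E|)%E] =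
    setT `&` (fun x => `|f x - fine 'E_P[f]%E|) @^-1` `[(expR 3 + 3 * expR 1) * M,
      +oo[%classic.
    by apply/seteqP; split=> x /=; rewrite in_itv/= andbT// => -[].
  have mE' : measurable_fun setT (fun x => `|f x - fine 'E_P[f]%E|).
    by apply: measurableT_comp => //; exact: measurable_funB.
  exact: mE'.
apply: (@le_trans _ _ (P A)).
  apply: le_measure; rewrite ?inE// => x /=.
  have := dist_mean_median_le; rewrite -(fineK Ef) /A /=; set c := fine _.
  rewrite !lee_fin => cm h.
  have := ler_distD c (f x) m; rewrite mulrDl in h.
  have := ler_normD (f x - m) (m - c); rewrite addrA subrK [`|m - c|]distrC.
  lra.
have e0 : 0 < expR (3 * p) :> R by exact: expR_gt0.
have : ((expR (3 * p))%:E * P A <= (2 * expR (p / 4))%:E)%E.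
  apply: le_trans momf.
  rewrite -[A]setIT -integral_indic// -ge0_integralZl//=; first last.
  - by apply/measurable_EFinP; exact: measurable_indic.
  apply: ge0_le_integral => //=.
  - by apply/measurable_EFinP; apply: measurable_funM => //; exact: measurable_indic.
  - by apply/measurable_EFinP; exact: mmom.
  move=> x _; rewrite -EFinM lee_fin indicE.
  case: (boolP (x \in A)) => [|_]; last by rewrite mulr0 powR_ge0.
  rewrite inE /A /= => h; rewrite mulr1 expRM ge0_ler_powR ?nnegrE ?expR_ge0 ?(ltW
    p0)//.
    by rewrite divr_ge0// ltW.
  by rewrite ler_pdivlMr.
have fA : P A \is a fin_num by rewrite fin_num_measure.
rewrite -(fineK fA) -EFinM !lee_fin mulrC -ler_pdivlMr// => /le_trans; apply.
rewrite -expRN -mulrA -expRD.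
have two : 2 <= expR 1 :> R by have := expR_ge1Dx (1 : R); lra.
apply: (@le_trans _ _ (expR 1 * expR (p / 4 - 3 * p))).
  by rewrite ler_pM2r ?expR_gt0.
by rewrite -expRD ler_expR; have := p2; lra.
Qed.

End deviation.

(** For a constant [f] both sides of the inequality that defines the event are [0], and the event
    has probability [1]; this is why almost everywhere constant functions are excluded. *)
Theorem corollary3p6 (R : realType) :
  exists2 C : R, 0 < C &
  forall (n : nat) (alpha beta K D : R) (Psi : 'rV[R]_n -> R)
    (mu : probability 'rV[R]_n R),
    1 < alpha -> alpha <= 2 -> 2 <= beta -> 1 <= K ->
    condition_C Psi -> growth_condition Psi K alpha beta ->
    0 < D -> mu `<< @lebesgue_rV R n -> mLSI mu Psi D ->
  forall (f : 'rV[R]_n -> R) (p : R),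
    mu.-integrable setT (EFin \o f) -> locally_lipschitz f ->
    ~ (exists c : R, {ae mu, forall x, f x = c}) ->
    beta <= p ->
    (mu [set x | (C * Lconst K D alpha beta)%:E *
                   Lnorm mu p%:E (fun y => (quasinorm Psi p (grad f y))%:E)
                 <= `|(f x)%:E - 'E_mu[f]|]
     <= (expR (- p))%:E)%E.
Proof.
have C0 : 0 < (expR 3 + 3 * expR 1) * expR 6 :> R.
  by rewrite mulr_gt0 ?addr_gt0 ?mulr_gt0 ?expR_gt0.
(* [expR 6] is the factor in [kappa], and [expR 3 + 3 * expR 1] is the one from [deviation_le]. *)
exists ((expR 3 + 3 * expR 1) * expR 6) => //.
move=> n alpha beta K D Psi mu a1 a2 b2 K1 CP GP D0 _ LSI f p intf lipf ncst bp.
have X0 : 0 < K * D by rewrite mulr_gt0//; lra.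
have L0 : 0 < Lconst K D alpha beta by apply: Lconst_gt0 => //; lra.
have p0 : 0 < p by lra.
have p2 : 2 <= p by lra.
have mf := continuous_measurable_rV (locally_lipschitz_continuous lipf).
have [m [med1 med2]] := exists_median mu mf.
pose F x := quasinorm Psi p (grad f x).
have F0 x : 0 <= F x by exact: quasinorm_ge0.
pose kappa := expR 6 * Lconst K D alpha beta.
have kappa0 : 0 < kappa by rewrite mulr_gt0 ?expR_gt0.
(* Stated for every positive [Phi] above the norm, because the norm itself may vanish and is then
   approached by small [Phi]. *)
have key (Phi : R) : 0 < Phi -> (\int[mu]_x (F x `^ p)%:E <= (Phi `^ p)%:E)%E ->
    (\int[mu]_x ((`|f x - m| / (kappa * Phi)) `^ p)%:E <= (2 * expR (p / 4))%:E)%E.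
  move=> Phi0 FPhi; have Pp0 : 0 < Phi `^ p by rewrite powR_gt0.
  apply: (central_moment_le CP GP a1 a2 b2 bp K1 D0 LSI Phi0 lipf) => //.
  have e x : (quasinorm Psi p (grad f x) / Phi) `^ p = (Phi `^ p)^-1 * F x `^ p.
    rewrite powRM ?invr_ge0 ?(ltW Phi0) ?F0// mulrC; congr (_ * _).
    by rewrite -(powR_inv1 (ltW Phi0)) -powRrM mulN1r powRN.
  under eq_integral do rewrite e.
  apply: (le_trans (lower_integralZl _ _ _)).
  - by move=> x; exact: powR_ge0.
  - by rewrite invr_gt0.
  - by rewrite -lee_pdivlMl ?invr_gt0// invrK mule1.
have -> : Lnorm mu p%:E (fun y => (quasinorm Psi p (grad f y))%:E) =
    ((\int[mu]_x (F x `^ p)%:E) `^ p^-1)%E.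
  rewrite unlock; congr (_ `^ _)%E; apply: eq_integral => x _.
  by rewrite gee0_abs ?poweR_EFin// lee_fin; exact: F0.
have Q0 : (0 <= \int[mu]_x (F x `^ p)%:E)%E.
  by apply: integral_ge0 => x _; rewrite lee_fin powR_ge0.
move: Q0 key; set Q := integral _ _ _.
have pn0 : p^-1 != 0 by rewrite invr_eq0 gt_eqF.
have CL0 : 0 < (expR 3 + 3 * expR 1) * expR 6 * Lconst K D alpha beta.
  exact: mulr_gt0.
case: Q => [q|_ _|//]; last first.
  (* An infinite norm makes the event empty, as ['E_mu[f]] is finite. *)
  rewrite poweRyr// gt0_muley ?lte_fin//.
  have Ef : 'E_mu[f]%E \is a fin_num.
    by rewrite unlock; exact: (integrable_fin_num _ intf).
  rewrite (_ : [set x | _] = set0) ?measure0 ?lee_fin ?expR_ge0//.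
  by apply/seteqP; split => // x /=; rewrite -(fineK Ef).
rewrite lee_fin poweR_EFin => q0 key.
have [qn|q1] := ltP 0 q.
  have Phi0 : 0 < q `^ p^-1 by rewrite powR_gt0.
  have := key _ Phi0; rewrite -powRrM mulVf ?gt_eqF// powRr1// lexx => /(_ isT) momf.
  have M0 : 0 < kappa * q `^ p^-1 by rewrite mulr_gt0.
  have := deviation_le intf M0 p2 momf; rewrite -EFinM.
  by rewrite /kappa !mulrA.
(* A zero norm makes every positive [Phi] admissible in [key]. By [mean_dist_le] the mean of
   [|f - m|] is then below every positive [e], so [f = m] almost everywhere. *)
exfalso; apply: ncst; exists m.
have {q0 q1} q0 : q = 0 by apply/eqP; rewrite eq_le q0 q1.
have dist0 : (\int[mu]_x `|f x - m|%:E <= 0)%E.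
  apply/lee_addgt0Pr => e e0; rewrite add0e.
  have c0 : 0 < 3 * expR 1 * kappa by rewrite !mulr_gt0 ?expR_gt0.
  pose Phi := e / (3 * expR 1 * kappa).
  have Phi0 : 0 < Phi by rewrite divr_gt0.
  have := key _ Phi0; rewrite q0 lee_fin powR_ge0 => /(_ isT) momf.
  have M0 : 0 < kappa * Phi by rewrite mulr_gt0.
  apply: (le_trans (mean_dist_le intf M0 p2 momf)); rewrite lee_fin.
  have -> : 3 * expR 1 * (kappa * Phi) = e.
    by rewrite /Phi; field; rewrite !gt_eqF ?expR_gt0.
  by [].
have mfm : measurable_fun setT (fun x => (f x - m)%:E).
  by apply/measurable_EFinP; exact: measurable_funB.
have /(ae_eq_integral_abs _ measurableT mfm) : (\int[mu]_x `|(f x - m)%:E| = 0)%E.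
  by apply/eqP; rewrite eq_le dist0; apply: integral_ge0.
apply: filterS => x /(_ I) [] /eqP; rewrite subr_eq0 => /eqP.
exact.
Qed.
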